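(* Let $\mathbf N\in\mathbb N^d$ be fixed. With $\mathcal L_{\mathbf N}$, $U_T^{\mathbf N}$, $U_{T,\delta}^{\mathbf N}$, $M_{\mathbf N}$ and $U_{\mathbf N,\delta,\epsilon}$ as defined in the context, define the exact solution set $$\mathcal S_{\mathbf N}=\left\{U\in H^2(0,T;\mathbb R^{M_{\mathbf N}}):\ \mathcal L_{\mathbf N}U=0\text{ in }L^2(0,T;\mathbb R^{M_{\mathbf N}}),\quad U(T)=U_T^{\mathbf N}\right\}.$$ Assume that $\mathcal S_{\mathbf N}\neq\emptyset$. Let $U_*^{\mathbf N}$ be the minimum-norm element of $\mathcal S_{\mathbf N}$ in $H^2(0,T;\mathbb R^{M_{\mathbf N}})$, namely $$U_*^{\mathbf N}=\operatorname*{arg\,min}_{U\in\mathcal S_{\mathbf N}}\|U\|_{H^2(0,T;\mathbb R^{M_{\mathbf N}})}.$$ If $\delta\to0$, $\epsilon\to0$ and $\dfrac{\delta^2}{\epsilon}\to0$ (with $\delta,\epsilon>0$), then $$U_{\mathbf N,\delta,\epsilon}\to U_*^{\mathbf N}\quad\text{strongly in }H^2(0,T;\mathbb R^{M_{\mathbf N}}).$$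
   Context: Let $d\ge1$, $T>0$, $R>0$, $\Omega_R=(-R,R)^d$, and $\mathbb N=\{0,1,2,\dots\}$. The coefficients are $a=a(\mathbf x,t)\in L^\infty(\Omega_R\times(0,T))$ and $\alpha=\alpha(\mathbf x,s)\in L^\infty(\Omega_R\times(0,T))$, both with values in $[0,\infty)$, and $\mathbf b=\mathbf b(\mathbf x,t)\in L^\infty(\Omega_R\times(0,T))^d$ with values in $\mathbb R^d$. Legendre basis: let $P_n$, $n\ge0$, be the classical Legendre polynomials on $(-1,1)$, and set $\Psi_n(x)=\left(\frac{2n+1}{2R}\right)^{1/2}P_n(x/R)$ for $x\in(-R,R)$. For $\mathbf n=(n_1,\dots,n_d)\in\mathbb N^d$ put $\Phi_{\mathbf n}(\mathbf x)=\prod_{j=1}^d\Psi_{n_j}(x_j)$. Then $\{\Phi_{\mathbf n}\}_{\mathbf n\in\mathbb N^d}$ is an orthonormal basis of $L^2(\Omega_R)$. For $\mathbf n,\mathbf N\in\mathbb N^d$, $\mathbf n\preceq\mathbf N$ means $0\le n_j\le N_j$ for all $j=1,\dots,d$, and $M_{\mathbf N}=\prod_{j=1}^d(N_j+1)$ is the number of multi-indices $\mathbf n\preceq\mathbf N$; vectors in $\mathbb R^{M_{\mathbf N}}$ are indexed by $\mathbf m\preceq\mathbf N$. Reduced coefficients: $$C_{\mathbf m\mathbf n}(t)=\int_{\Omega_R}a(\mathbf x,t)\,\Delta\Phi_{\mathbf n}(\mathbf x)\,\Phi_{\mathbf m}(\mathbf x)\,d\mathbf x-\int_{\Omega_R}\bigl(\mathbf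 b(\mathbf x,t)\cdot\nabla\Phi_{\mathbf n}(\mathbf x)\bigr)\Phi_{\mathbf m}(\mathbf x)\,d\mathbf x,$$ $$E_{\mathbf m\mathbf n}(s)=\int_{\Omega_R}\alpha(\mathbf x,s)\,\Delta\Phi_{\mathbf n}(\mathbf x)\,\Phi_{\mathbf m}(\mathbf x)\,d\mathbf x .$$ Residual operator: for $V=(v_{\mathbf m})_{\mathbf m\preceq\mathbf N}\in H^2(0,T;\mathbb R^{M_{\mathbf N}})$, $\mathcal L_{\mathbf N}V=((\mathcal L_{\mathbf N}V)_{\mathbf m})_{\mathbf m\preceq\mathbf N}$ with $$(\mathcal L_{\mathbf N}V)_{\mathbf m}(t)=v_{\mathbf m}'(t)-\sum_{\mathbf n\preceq\mathbf N}C_{\mathbf m\mathbf n}(t)v_{\mathbf n}(t)-\sum_{\mathbf n\preceq\mathbf N}\int_0^tE_{\mathbf m\mathbf n}(t-\tau)v_{\mathbf n}(\tau)\,d\tau .$$ This is a bounded operator from $H^2(0,T;\mathbb R^{M_{\mathbf N}})$ to $L^2(0,T;\mathbb R^{M_{\mathbf N}})$. Data: $u_T\in L^2(\Omega_R)$ is the exact terminal data and, for each $\delta>0$, $u_T^\delta\in L^2(\Omega_R)$ is noisy terminal data. Set $U_T^{\mathbf N}=\left(\int_{\Omega_R}u_T\Phi_{\mathbf m}\,d\mathbf x\right)_{\mathbf m\preceq\mathbf N}$ and $U_{T,\delta}^{\mathbf N}=\left(\int_{\Omega_R}u_T^\delta\Phi_{\mathbf m}\,d\mathbf x\right)_{\mathbf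 m\preceq\mathbf N}$. It is assumed that $\|U_{T,\delta}^{\mathbf N}-U_T^{\mathbf N}\|_{\mathbb R^{M_{\mathbf N}}}\le\delta$. Tikhonov minimizers: for $\delta>0$ let $\mathcal H_{\mathbf N,\delta}=\{U\in H^2(0,T;\mathbb R^{M_{\mathbf N}}):U(T)=U_{T,\delta}^{\mathbf N}\}$, and for $\epsilon>0$ let $$J_{\mathbf N,\delta,\epsilon}(U)=\|\mathcal L_{\mathbf N}U\|_{L^2(0,T;\mathbb R^{M_{\mathbf N}})}^2+\epsilon\|U\|_{H^2(0,T;\mathbb R^{M_{\mathbf N}})}^2,\qquad U\in\mathcal H_{\mathbf N,\delta}.$$ $U_{\mathbf N,\delta,\epsilon}$ denotes the unique minimizer of $J_{\mathbf N,\delta,\epsilon}$ over $\mathcal H_{\mathbf N,\delta}$. The $H^2$ norm is the standard Hilbert norm. Convergence as $\delta,\epsilon\to0$, $\delta^2/\epsilon\to0$ means convergence along every sequence $(\delta_k,\epsilon_k)$ of positive numbers with $\delta_k\to0$, $\epsilon_k\to0$, $\delta_k^2/\epsilon_k\to0$. *)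

(* Defs.v *)
From HB Require Import structures.
From mathcomp Require Import all_boot all_order all_algebra.
From mathcomp Require Import all_classical all_reals all_analysis.
Set Implicit Arguments.
Unset Strict Implicit.
Unset Printing Implicit Defensive.
Import Order.TTheory GRing.Theory Num.Theory numFieldNormedType.Exports.
Local Open Scope classical_set_scope.
Local Open Scope ring_scope.

Section lebesgue_tuple.
Context {R : realType}.
Local Notation T := (measurableTypeR R).

Definition tuple_cons (k : nat) (p : T * k.-tuple T) : k.+1.-tuple T :=
  [tuple of p.1 :: p.2].

Lemma measurable_tuple_cons k : measurable_fun [set: T * k.-tuple T] (@tuple_cons k).
Proof. exact: measurable_cons. Qed.

Section step.
Context (k : nat) (nu : {sigma_finite_measure set (k.-tuple T) -> \bar R}).

Definition lebesgue_cons : set (k.+1.-tuple T) -> \bar R :=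
  pushforward (@lebesgue_measure R \x nu)%E (@tuple_cons k).

Let m : {measure set (k.+1.-tuple T) -> \bar R} :=
  measure_function_pushforward__canonical__measure_function_Measure
    (@lebesgue_measure R \x nu)%E (@measurable_tuple_cons k).

HB.instance Definition _ :=
  isMeasure.Build _ _ _ lebesgue_cons (measure0 m) (measure_ge0 m)
    (@measure_semi_sigma_additive _ _ _ m).

Let lebesgue_cons_sigma_finite : sigma_finite setT lebesgue_cons.
Proof.
have /sigma_finiteP[F [FT ndF mF]] := sigma_finiteT (@lebesgue_measure R).
have /sigma_finiteP[G [GT ndG mG]] := sigma_finiteT nu.
pose uncons (v : k.+1.-tuple T) : T * k.-tuple T := (thead v, [tuple of behead v]).
have consK : cancel (@tuple_cons k) uncons.
  by move=> [x v]; congr pair; apply: val_inj.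
have muncons : measurable_fun setT uncons.
  apply/measurable_fun_pairP; split.
    exact: measurable_tnth.
  exact: measurable_behead.
exists (fun i => uncons @^-1` (F i `*` G i)).
  rewrite -preimage_bigcup -[LHS](preimage_setT uncons); congr (_ @^-1` _).
  rewrite -setXTT FT GT; apply/seteqP; split => -[x y] /=.
    move=> [[n _ Fnx] [l _ Gly]]; exists (maxn n l) => //; split.
      by move: x Fnx; exact/subsetPset/ndF/leq_maxl.
    by move: y Gly; exact/subsetPset/ndG/leq_maxr.
  by move=> [n _ []/= ? ?]; split; exists n.
move=> i; have [mFi Fi] := mF i; have [mGi Gi] := mG i; split.
  rewrite -[X in measurable X]setTI; apply: muncons => //; exact: measurableX.
rewrite /lebesgue_cons /pushforward -comp_preimage.
rewrite (_ : uncons \o _ = id) ?preimage_id; last exact/funext.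
by rewrite product_measure1E// lte_mul_pinfty// ge0_fin_numE.
Qed.

HB.instance Definition _ :=
  Measure_isSigmaFinite.Build _ _ _ lebesgue_cons lebesgue_cons_sigma_finite.
End step.

(* Lebesgue measure on R^d, R^d being d.-tuple R with the product sigma-algebra;
   lebesgue_tuple_box below is its characterisation. *)
Fixpoint lebesgue_tuple (d : nat) : {sigma_finite_measure set (d.-tuple T) -> \bar R} :=
  if d is k.+1 then lebesgue_cons (lebesgue_tuple k) else dirac [tuple].

Lemma lebesgue_tuple_box d (A : 'I_d -> set T) : (forall j, measurable (A j)) ->
  lebesgue_tuple d [set x | forall j, A j (tnth x j)] = (\prod_(j < d) lebesgue_measure (A j))%E.
Proof.
elim: d A => [|d IH] A mA /=.
  rewrite big_ord0 diracE mem_set//= => j; by case: j.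
rewrite big_ord_recl -IH//.
rewrite -product_measure1E//.
  congr ((_ \x _)%E _); apply/seteqP; split => -[x v]/=.
    move=> h; split; first by have := h ord0.
    by move=> j; have := h (lift ord0 j); rewrite tnthS.
  case=> h1 h2 j.
  have [->//|i0] := eqVneq j ord0.
  case: (unliftP ord0 j) i0 => [i ->|->]; last by rewrite eqxx.
  by rewrite tnthS => _; exact: h2.
rewrite [X in measurable X](_ : _ = \bigcap_(j in [set: 'I_d]) ((fun x : d.-tuple T => tnth x j) @^-1` A (lift ord0 j))); last first.
  by apply/seteqP; split => x /=; [move=> h j _; exact: h|move=> h j; exact: h].
apply: fin_bigcap_measurable => // j _.
rewrite -[X in measurable X]setTI; exact: measurable_tnth.
Qed.
End lebesgue_tuple.

Definition in_Lp {R : realType} {d} {X : measurableType d}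
    (nu : {measure set X -> \bar R}) (D : set X) (p : \bar R) (f : X -> R) : Prop :=
  f \_ D \in Lfun nu p.

(* H^2(0, T): elements are represented by functions R -> R of which only the
   a.e. class on ]0, T[ matters; derivatives are weak derivatives.  As is usual
   on an interval (Brezis, Functional Analysis, Sobolev Spaces and PDE,
   Section 8.2), the test functions are those of class C^1 with compact support
   in ]0, T[. *)
Section sobolev.
Context {R : realType}.
Local Notation mu := (@lebesgue_measure R).
Variable T : R.
Implicit Types v g w : R -> R.

Definition test_fun : set (R -> R) :=
  [set phi : R -> R | [/\ forall x, derivable phi x 1, continuous phi^`()%classic
    & exists a b, [/\ 0 < a, b < T & forall x, x \notin `[a, b] -> phi x = 0]]].

Definition is_weak_deriv v g : Prop := forall phi, test_fun phi ->
  \int[mu]_(t in `]0, T[%classic) (v t * phi^`()%classic t) =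
  - \int[mu]_(t in `]0, T[%classic) (g t * phi t).

Definition L2 v : Prop := in_Lp mu `]0, T[%classic 2%:E v.

Definition wderiv v : R -> R := xget (cst 0) [set g | L2 g /\ is_weak_deriv v g].

Definition H1 v : Prop := L2 v /\ exists g, L2 g /\ is_weak_deriv v g.

Definition H2 v : Prop := H1 v /\ H1 (wderiv v).

(* Point values of v in H^1(0, T) are those of its continuous representative. *)
Definition cont_rep v : R -> R := xget (cst 0)
  [set w | {within `[0, T]%classic, continuous w} /\ ae_eq mu `]0, T[%classic w v].

(* I-indexed families of functions stand for R^I-valued functions. *)
Section vector_valued.
Context {I : finType}.
Implicit Types V : I -> R -> R.

Definition H2v V : Prop := forall m, H2 (V m).

Definition normL2 V : R := Num.sqrt (\sum_m \int[mu]_(t in `]0, T[%classic) (V m t ^+ 2)).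

Definition normH2 V : R := Num.sqrt (normL2 V ^+ 2
  + normL2 (fun m => wderiv (V m)) ^+ 2
  + normL2 (fun m => wderiv (wderiv (V m))) ^+ 2).

Definition norm2 (y : I -> R) : R := Num.sqrt (\sum_m y m ^+ 2).

End vector_valued.
End sobolev.

Section legendre.
Context {R : realType}.

(* Rodrigues' formula *)
Definition legendre (n : nat) : {poly R} :=
  ((2 ^ n * n`!)%:R)^-1 *: (('X^2 - 1) ^+ n)^`(n).

Definition Psi (rho : R) (n : nat) (x : R) : R :=
  Num.sqrt ((2 * n + 1)%:R / (2 * rho)) * (legendre n).[x / rho].

Context {d : nat}.

Definition Phi (rho : R) (n : 'I_d -> nat) (x : 'rV[R]_d) : R :=
  \prod_(j < d) Psi rho (n j) (x 0 j).

Definition partial (j : 'I_d) (f : 'rV[R]_d -> R) : 'rV[R]_d -> R :=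
  fun x => 'D_(delta_mx 0 j) f x.

Definition laplacian (f : 'rV[R]_d -> R) (x : 'rV[R]_d) : R :=
  \sum_(j < d) partial j (partial j f) x.

End legendre.

(* The multi-indices n <= N. *)
Definition mindex (d : nat) (N : 'I_d -> nat) : Type :=
  {dffun forall j : 'I_d, 'I_(N j).+1}.
HB.instance Definition _ (d : nat) (N : 'I_d -> nat) := Finite.on (mindex N).

Definition mindex_nat (d : nat) (N : 'I_d -> nat) (n : mindex N) : 'I_d -> nat :=
  fun j => n j.
Coercion mindex_nat : mindex >-> Funclass.

Section reduction.
Context {R : realType} {d : nat}.
Local Notation mu := (@lebesgue_measure R).
Local Notation Rd := (d.-tuple (measurableTypeR R)).
Local Notation lambda := (@lebesgue_tuple R d).
Variables (rho T : R).

Definition cube : set Rd := [set x | forall j, tnth x j \in `]- rho, rho[].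

Definition cylinder : set (Rd * measurableTypeR R) := cube `*` `]0, T[%classic.

Definition Linf (f : Rd * measurableTypeR R -> R) : Prop :=
  in_Lp (lambda \x mu)%E cylinder +oo%E f.

Definition ae_ge0 (f : Rd * measurableTypeR R -> R) : Prop :=
  {ae (lambda \x mu)%E, forall z, cylinder z -> 0 <= f z}.

Definition rv (x : Rd) : 'rV[R]_d := \row_j tnth x j.

Variables (a alpha : Rd * measurableTypeR R -> R)
  (b : 'I_d -> Rd * measurableTypeR R -> R).

Definition Ccoef (m n : 'I_d -> nat) (t : R) : R :=
  \int[lambda]_(x in cube)
    (a (x, t) * laplacian (Phi rho n) (rv x) * Phi rho m (rv x))
  - \int[lambda]_(x in cube)
    ((\sum_(j < d) b j (x, t) * partial j (Phi rho n) (rv x)) * Phi rho m (rv x)).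

Definition Ecoef (m n : 'I_d -> nat) (s : R) : R :=
  \int[lambda]_(x in cube)
    (alpha (x, s) * laplacian (Phi rho n) (rv x) * Phi rho m (rv x)).

Definition moment (u : Rd -> R) (m : 'I_d -> nat) : R :=
  \int[lambda]_(x in cube) (u x * Phi rho m (rv x)).

Variable N : 'I_d -> nat.
Implicit Types V : mindex N -> R -> R.

Definition residual V (m : mindex N) (t : R) : R :=
  wderiv T (V m) t - \sum_(n : mindex N) Ccoef m n t * V n t
  - \sum_(n : mindex N)
      \int[mu]_(tau in `]0, t[%classic) (Ecoef m n (t - tau) * V n tau).

Definition moments (u : Rd -> R) : mindex N -> R := fun m => moment u m.

Definition terminal_value V (y : mindex N -> R) : Prop :=
  forall m, cont_rep T (V m) T = y m.

Definition tikhonov (eps : R) V : R :=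
  normL2 T (residual V) ^+ 2 + eps * normH2 T V ^+ 2.

Definition admissible (y : mindex N -> R) : set (mindex N -> R -> R) :=
  [set V | H2v T V /\ terminal_value V y].

Definition exact_solutions (y : mindex N -> R) : set (mindex N -> R -> R) :=
  [set V | [/\ H2v T V, forall m, ae_eq mu `]0, T[%classic (residual V m) (cst 0)
    & terminal_value V y]].

End reduction.

Arguments moments {R d} rho N u m.

Definition argmin {X : Type} {R : realType} (S : set X) (F : X -> R) : set X :=
  [set x | S x /\ forall y, S y -> F x <= F y].

(* Main.v *)
Require Import Defs.
From HB Require Import structures.
From mathcomp Require Import all_boot all_order all_algebra.
From mathcomp Require Import all_classical all_reals all_analysis.
From mathcomp Require Import measurable_realfun ess_sup_inf.
From mathcomp Require Import ring lra.
Set Implicit Arguments.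
Unset Strict Implicit.
Unset Printing Implicit Defensive.
Import Order.TTheory GRing.Theory Num.Theory numFieldNormedType.Exports.
Local Open Scope classical_set_scope.
Local Open Scope ring_scope.

(** The argument takes place in the Hilbert space of H^2(0, T) functions with
    values in R^I, where I is the finite set of multi-indices.  For terminal
    data y, the quantity
<<
      gap V = |L V|^2 + T |V(T) - y|^2
>>
    is a nonnegative, continuous and convex function of V, and it vanishes
    exactly on the exact solutions: both V |-> L V and the trace V |-> V(T),
    viewed as a constant function of squared L^2 norm T |V(T)|^2, are bounded
    linear operators from H^2 to L^2 (bounded_op_residual, bounded_op_trace).

    Selection of U* and stability come together (min_norm_selection).  Let m be
    the limit, as eta decreases to 0, of the infimum of |V|^2 over the V with
    gap V <= eta.  If U and V have a small gap and squared norms close to m, then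
    their midpoint has a small gap too, so its squared norm is nearly at least m,
    and the parallelogram law forces |U - V| to be small.  Completeness of H^2 turns this into a solution U* with
    |U*|^2 = m, which therefore has least norm, and into the stability property
    used below: every V whose gap is at most eta and whose squared norm is at
    most |U*|^2 + eta is close to U*.  The usual extraction of a weakly
    convergent subsequence is replaced by this uniform convexity argument, and
    convergence is obtained directly for the whole family.

    The Tikhonov minimizers satisfy the two conditions (tikhonov_estimate).
    With c the difference between the noisy and the exact terminal data, the
    function U* + c, with c constant in time, is admissible, and L (U* + c) = L c
    has squared norm O(delta^2).  Comparing the functional at the minimizer U
    and at U* + c gives
<<
      |L U|^2 + eps |U|^2 <= O(delta^2) + eps (|U*|^2 + O(delta + delta^2)),
>>
    so that |U|^2 <= |U*|^2 + O(delta^2 / eps + delta + delta^2), while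
    |L U|^2, and with it gap U, is O(delta^2 + eps + eps delta + eps delta^2).

    The remaining lemmas supply the functional analysis this relies on: L^2 is
    complete, a function with zero weak derivative is constant, weak derivatives
    pass to L^2 limits (so H^2 is complete), the value at T is controlled by the
    H^1 norm, and the reduced coefficients are essentially bounded because the
    basis functions are products of polynomials on a bounded cube, which makes
    multiplication and Volterra convolution by them bounded on L^2. *)

(** * Minimum-norm selection in a complete uniformly convex setting *)

(** Abstract form of the selection argument: [q] is the squared norm, [gap]
    measures the violation of the constraints, and [q_mid] is the parallelogram
    law for the midpoint operation.  The last clause of the conclusion is what
    makes the selected point stable under perturbation of the constraints. *)
Lemma min_norm_selection (R : realType) (X : Type) (P : set X)
    (q gap : X -> R) (mid : X -> X -> X) (dist2 : X -> X -> R)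
    (q_ge0 : forall u, 0 <= q u) (gap_ge0 : forall u, 0 <= gap u)
    (P_mid : forall u v, P u -> P v -> P (mid u v))
    (q_mid : forall u v, P u -> P v ->
       q (mid u v) = (q u + q v) / 2 - dist2 u v / 4)
    (gap_mid : forall u v, P u -> P v -> gap (mid u v) <= (gap u + gap v) / 2)
    (complete : forall u : nat -> X, (forall n, P (u n)) ->
       (forall e, 0 < e -> exists K, forall i j, (K <= i)%N -> (K <= j)%N ->
          dist2 (u i) (u j) <= e) ->
       exists2 v, P v & [/\ q (u n) @[n --> \oo] --> q v
         & gap (u n) @[n --> \oo] --> (0 : R) -> gap v = 0])
    (ex_sol : exists2 u, P u & gap u = 0) :
  exists ustar, [/\ P ustar, gap ustar = 0,
    forall v, P v -> gap v = 0 -> q ustar <= q v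
    & forall e, 0 < e -> exists2 eta, 0 < eta & forall u, P u ->
        gap u <= eta -> q u <= q ustar + eta -> dist2 u ustar <= e].
Proof.
(* The supremum m of A is the limit of inf {q u | gap u <= eta} as eta
   decreases to 0. *)
pose A := [set c | exists2 eta, 0 < eta & forall u, P u -> gap u <= eta -> c <= q u].
have supA : has_sup A.
  split; first by exists 0, 1.
  have [u Pu gu] := ex_sol; exists (q u) => c [eta eta0]; apply => //.
  by rewrite gu ltW.
set m := sup A.
have lower e : 0 < e -> exists2 eta, 0 < eta &
    forall u, P u -> gap u <= eta -> m - e <= q u.
  move=> e0; have [c [eta eta0 Hc] mc] := sup_adherent e0 supA.
  exists eta => // u Pu gu; apply: le_trans (Hc _ Pu gu); exact/ltW.
(* The midpoint of u and v has gap at most eta, so q there is at least m - e/8,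
   whereas the parallelogram law puts it at most at m + e/8 - dist2 u v / 4. *)
have close e : 0 < e -> exists2 eta, 0 < eta & forall u v, P u -> P v ->
    gap u <= eta -> gap v <= eta -> q u <= m + eta -> q v <= m + eta ->
    dist2 u v <= e.
  move=> e0; have [|eta eta0 Hlow] := lower (e / 8); first lra.
  exists (Num.min eta (e / 8)); first by rewrite lt_min eta0; lra.
  move=> u v Pu Pv; rewrite !le_min => /andP[gu _] /andP[gv _].
  move=> qu qv; have m8 : Num.min eta (e / 8) <= e / 8 by rewrite ge_min lexx orbT.
  have := Hlow _ (P_mid _ _ Pu Pv).
  rewrite q_mid// => h; have {h} := h (le_trans (gap_mid _ _ Pu Pv) _); move=> h; have := h ltac:(lra); lra.
(* A minimizing sequence: if no such u existed, m + 1/(n+1) would belong to A. *)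
have near_inf n : exists u, [/\ P u, gap u <= n.+1%:R^-1 & q u <= m + n.+1%:R^-1].
  apply: contrapT => /forallNP no.
  suff /ub_le_sup : A (m + n.+1%:R^-1).
    move=> /(_ (proj2 supA)); rewrite -/m gerDl leNgt invr_gt0 ltr0n//.
  exists n.+1%:R^-1; first by rewrite invr_gt0 ltr0n.
  move=> u Pu gu; rewrite leNgt; apply/negP => qu.
  by apply: (no u); split => //; exact/ltW.
have [w Hw] := choice near_inf.
have small e : 0 < e -> exists K, forall n, (K <= n)%N -> n.+1%:R^-1 <= e :> R.
  move=> e0; have [K _ HK] := @near_infty_natSinv_lt R (PosNum e0).
  by exists K => n Kn; apply/ltW/HK.
have [ustar Pustar [qcv gcv]] : exists2 v, P v & [/\ q (w n) @[n --> \oo] --> q v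
         & gap (w n) @[n --> \oo] --> (0 : R) -> gap v = 0].
  apply: complete; first by move=> n; case: (Hw n).
  move=> e e0; have [eta eta0 Heta] := close e e0.
  have [K HK] := small eta eta0; exists K => i j Ki Kj.
  have [Pi gi qi] := Hw i; have [Pj gj qj] := Hw j.
  apply: Heta => //; [exact: le_trans gi (HK _ Ki)|exact: le_trans gj (HK _ Kj)
    |apply: le_trans qi _|apply: le_trans qj _]; by rewrite lerD2l HK.
have gap_star : gap ustar = 0.
  apply: gcv; apply/cvgrPdist_le => e e0; have [K HK] := small e e0.
  exists K => // n /= Kn; rewrite sub0r normrN ger0_norm//.
  by have [_ gn _] := Hw n; exact: le_trans gn (HK _ Kn).
have q_star : q ustar = m.
  apply/eqP; rewrite eq_le; apply/andP; split; apply/ler_addgt0Pr => e e0.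
    apply: (cvgr_to_le qcv); have [K HK] := small e e0.
    exists K => // n /= Kn; have [_ _ qn] := Hw n.
    by apply: le_trans qn _; rewrite lerD2l HK.
  rewrite -lerBlDr; have [eta eta0 Heta] := lower e e0.
  apply: (cvgr_to_ge qcv); have [K HK] := small eta eta0; exists K => // n /= Kn.
  by have [Pn gn _] := Hw n; apply: Heta => //; exact: le_trans gn (HK _ Kn).
exists ustar; split=> //.
  move=> v Pv gv; rewrite q_star; apply/ler_addgt0Pr => e e0.
  rewrite -lerBlDr; have [eta eta0 Heta] := lower e e0.
  by apply: Heta => //; rewrite gv ltW.
move=> e e0; have [eta eta0 Heta] := close e e0; exists eta => // u Pu gu.
by rewrite q_star => qu; apply: Heta => //; rewrite ?gap_star ?q_star ?lerDl ltW.
Qed.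

(** * The space L^2 of a finite measure *)

(** The source of all Cauchy-Schwarz inequalities below; [c] is allowed to be 0,
    where the polynomial is affine and nonnegativity forces [b = 0]. *)
Lemma quadratic_ge0_discr (R : realFieldType) (a b c : R) : 0 <= c ->
  (forall s, 0 <= a + 2 * s * b + s ^+ 2 * c) -> b ^+ 2 <= a * c.
Proof.
rewrite le_eqVlt => /predU1P[<-|c_gt0] pos.
  have [->|b0] := eqVneq b 0; first by rewrite expr0n mulr0.
  have := pos (- (a + 1) / (2 * b)); rewrite mulr0 addr0.
  have -> : 2 * (- (a + 1) / (2 * b)) * b = - (a + 1) by field.
  by rewrite opprD addrA subrr sub0r oppr_ge0 ler10.
have := pos (- b / c).
have -> : a + 2 * (- b / c) * b + (- b / c) ^+ 2 * c = a - b ^+ 2 / c.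
  by field; rewrite gt_eqF.
by rewrite subr_ge0 ler_pdivrMr.
Qed.

Section L2.
Context {R : realType} d {X : measurableType d} (mu : {measure set X -> \bar R}).
Variable D : set X.
Hypothesis mD : measurable D.
Implicit Types (f g h : X -> R) (s M : R).
Local Notation L2 := (in_Lp mu D 2%:E).
Local Notation ip f g := (\int[mu]_(x in D) (f x * g x)).
Local Notation sq f := (\int[mu]_(x in D) (f x ^+ 2)).

Lemma EFin_Rintegral f : mu.-integrable D (EFin \o f) ->
  (\int[mu]_(x in D) f x)%:E = (\int[mu]_(x in D) (f x)%:E)%E.
Proof. by move=> fi; rewrite /Rintegral fineK//; exact: integrable_fin_num. Qed.

Lemma ae_dominated_Rintegral f g : measurable_fun D f ->
  mu.-integrable D (EFin \o g) -> {ae mu, forall x, D x -> `|f x| <= g x} ->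
  mu.-integrable D (EFin \o f) /\
  `|\int[mu]_(x in D) f x| <= \int[mu]_(x in D) g x.
Proof.
move=> mf gi fg; have ign := integrable_norm gi.
have le : (\int[mu]_(x in D) `|(f x)%:E| <= \int[mu]_(x in D) `|(g x)%:E|)%E.
  apply: ae_ge0_le_integral => //.
  - by apply: measurableT_comp => //; exact/measurable_EFinP.
  - exact: (measurable_int mu ign).
  by apply: filterS fg => x h Dx; rewrite lee_fin (le_trans (h Dx))// ler_norm.
have fi : mu.-integrable D (EFin \o f).
  apply/integrableP; split; first exact/measurable_EFinP.
  by apply: (le_lt_trans le); case/integrableP : gi.
split => //; apply: (le_trans (le_normr_Rintegral mD fi)).
have fin := integrable_norm fi.
rewrite -lee_fin !EFin_Rintegral// [leLHS](_ : _ = \int[mu]_(x in D) (`|f x|%:E))%E//.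
have ae_g : ae_eq mu D (fun x => (g x)%:E) (fun x => `|g x|%:E).
  by apply: filterS fg => x h Dx; rewrite ger0_norm// (le_trans _ (h Dx)).
have -> : (\int[mu]_(x in D) (g x)%:E = \int[mu]_(x in D) `|g x|%:E)%E.
  by apply: ae_eq_integral => //; [exact: (measurable_int mu gi)|exact: (measurable_int mu ign)].
exact: le.
Qed.

Lemma cvg_Rintegral (fn : nat -> X -> R) f g :
  (forall n, measurable_fun D (fn n)) -> measurable_fun D f ->
  (forall x, D x -> fn n x @[n --> \oo] --> f x) ->
  mu.-integrable D (EFin \o g) -> (forall n x, D x -> `|fn n x| <= g x) ->
  \int[mu]_(x in D) fn n x @[n --> \oo] --> \int[mu]_(x in D) f x.
Proof.
move=> mfn mf fnf ig fng.
have [_ _ cv] : [/\ mu.-integrable D (EFin \o f),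
  [sequence \int[mu]_(x in D) `|(fn n x)%:E - (f x)%:E|]_n @ \oo --> 0 &
  [sequence \int[mu]_(x in D) (fn n x)%:E]_n @ \oo --> \int[mu]_(x in D) (f x)%:E]%E.
  apply: dominated_convergence ig _ => //.
  - by move=> n; exact/measurable_EFinP.
  - exact/measurable_EFinP.
  - apply: aeW => x Dx; apply/fine_cvgP; split; [exact: nearW|exact: fnf].
  - by apply: aeW => x n Dx; rewrite lee_fin fng.
apply: fine_cvg; rewrite fineK; first exact: cv.
apply: integrable_fin_num => //; apply: (le_integrable mD _ _ ig).
  exact/measurable_EFinP.
move=> x Dx /=; rewrite lee_fin; apply: (le_trans _ (ler_norm _)).
apply: (cvgr_to_le (cvg_norm (fnf _ Dx))); apply: nearW => n; exact: fng.
Qed.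

(** Every L^2 computation below goes through this characterisation by ordinary
    integrability of the square, which avoids the L^p norm altogether. *)
Lemma in_L2P f : L2 f <->
  measurable_fun D f /\ mu.-integrable D (EFin \o (fun x => f x ^+ 2)).
Proof.
rewrite /in_Lp; split.
  move=> /[dup] /sub_Lfun_mfun; rewrite inE/= => mf /Lfun2_integrable_sqr f2.
  have mDf : measurable_fun D f by exact/(measurable_restrictT _ mD).
  split => //; apply/(integrable_mkcond _ mD).
  apply: eq_integrable f2 => // x _ /=.
  rewrite /= /patch; case: ifPn => //= _; by rewrite expr0n.
case=> mf /integrableP[mf2 f2].
have mfD : measurable_fun setT (f \_ D) by exact/(measurable_restrictT _ mD).
rewrite inE/=; apply/andP; split; first by rewrite inE.
rewrite inE/= /finite_norm unlock /=.
apply: poweR_lty; refine (le_lt_trans _ f2).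
rewrite [in leRHS]integral_mkcond; apply: ge0_le_integral => //=.
- apply/measurable_EFinP.
  apply: (@measurableT_comp _ _ _ _ _ _ (@powR R ^~ 2)) => //.
  exact: measurableT_comp.
- by apply/(measurable_restrictT _ mD); exact: (measurableT_comp (@abse_measurable R setT) mf2).
move=> x _; rewrite powR_mulrn// /patch; case: ifPn => _ /=.
  by rewrite lee_fin normrX.
by rewrite normr0 expr0n.
Qed.

Lemma integrableZl_real s f : mu.-integrable D (EFin \o f) ->
  mu.-integrable D (EFin \o (fun x => s * f x)).
Proof. by move/(integrableZl mD s); apply: eq_integrable => // x _ /=; rewrite EFinM. Qed.

Lemma integrableD_real f g : mu.-integrable D (EFin \o f) ->
  mu.-integrable D (EFin \o g) -> mu.-integrable D (EFin \o (fun x => f x + g x)).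
Proof. by move=> fi gi; have := integrableD mD fi gi; exact: eq_integrable. Qed.

Lemma in_L2_measurable f : L2 f -> measurable_fun D f.
Proof. by case/in_L2P. Qed.

Lemma in_L2_mul f g : L2 f -> L2 g ->
  mu.-integrable D (EFin \o (fun x => f x * g x)).
Proof.
move=> /in_L2P[mf f2] /in_L2P[mg g2].
have := integrableD mD f2 g2.
apply: le_integrable => //; first exact/measurable_EFinP/measurable_funM.
move=> x _ /=; rewrite lee_fin [leRHS]ger0_norm ?addr_ge0 ?sqr_ge0// normrM.
rewrite -[f x ^+ 2]real_normK ?num_real// -[g x ^+ 2]real_normK ?num_real//.
have := sqr_ge0 (`|f x| - `|g x|); have := sqr_ge0 (`|f x| + `|g x|); nra.
Qed.

Lemma in_L2_sqr f : L2 f -> mu.-integrable D (EFin \o (fun x => f x ^+ 2)).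
Proof. by case/in_L2P. Qed.

Lemma in_L2_axpy s f g : L2 f -> L2 g -> L2 (fun x => f x + s * g x).
Proof.
move=> Lf Lg; have [mf f2] := (in_L2P f).1 Lf; have [mg g2] := (in_L2P g).1 Lg.
apply/in_L2P; split; first by apply: measurable_funD => //; exact: measurable_funM.
have := integrableD mD (integrableD mD f2 (integrableZl mD (2 * s) (in_L2_mul Lf Lg)))
  (integrableZl mD (s ^+ 2) g2).
apply: eq_integrable => // x _ /=.
rewrite -!EFinM -!EFinD; congr EFin; ring.
Qed.

Lemma in_L2_0 : L2 (cst 0).
Proof.
apply/in_L2P; split => //.
under eq_fun do rewrite expr0n /=.
exact: integrable0.
Qed.

Lemma in_L2D f g : L2 f -> L2 g -> L2 (fun x => f x + g x).
Proof.
move=> Lf Lg; have := in_L2_axpy 1 Lf Lg.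
by under eq_fun do rewrite mul1r.
Qed.

Lemma in_L2B f g : L2 f -> L2 g -> L2 (fun x => f x - g x).
Proof.
move=> Lf Lg; have := in_L2_axpy (-1) Lf Lg.
by under eq_fun do rewrite mulN1r.
Qed.

Lemma in_L2Z s f : L2 f -> L2 (fun x => s * f x).
Proof.
move=> Lf; have := in_L2_axpy s in_L2_0 Lf.
by under eq_fun do rewrite add0r.
Qed.

Lemma sq_ge0 f : 0 <= sq f.
Proof. by apply: Rintegral_ge0 => x _; exact: sqr_ge0. Qed.

Lemma ip_axpy s f g h : L2 f -> L2 g -> L2 h ->
  ip (fun x => f x + s * g x) h = ip f h + s * ip g h.
Proof.
move=> Lf Lg Lh; rewrite -RintegralZl//; last exact: in_L2_mul.
rewrite -RintegralD//; [|exact: in_L2_mul|exact/integrableZl_real/in_L2_mul].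
by apply: eq_Rintegral => x _; rewrite mulrDl mulrA.
Qed.

Lemma sq_axpy s f g : L2 f -> L2 g ->
  sq (fun x => f x + s * g x) = sq f + 2 * s * ip f g + s ^+ 2 * sq g.
Proof.
move=> Lf Lg; rewrite -!RintegralZl//; [|exact: in_L2_sqr|exact: in_L2_mul].
rewrite -!RintegralD//.
- by apply: eq_Rintegral => x _; ring.
- apply: integrableD_real; first exact: in_L2_sqr.
  exact/integrableZl_real/in_L2_mul.
- exact/integrableZl_real/in_L2_sqr.
- exact: in_L2_sqr.
- exact/integrableZl_real/in_L2_mul.
Qed.

Lemma cauchy_schwarz_L2 f g : L2 f -> L2 g -> (ip f g) ^+ 2 <= sq f * sq g.
Proof.
move=> Lf Lg; apply: quadratic_ge0_discr; first exact: sq_ge0.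
by move=> s; rewrite -sq_axpy//; exact: sq_ge0.
Qed.

Lemma ae_eq_Rintegral f g : measurable_fun D f -> measurable_fun D g ->
  ae_eq mu D f g -> \int[mu]_(x in D) f x = \int[mu]_(x in D) g x.
Proof.
move=> mf mg fg; congr fine; apply: ae_eq_integral => //; try exact/measurable_EFinP.
by apply: filterS fg => x /[apply] ->.
Qed.

Lemma ae_eq_ip f1 f2 g1 g2 : L2 f1 -> L2 f2 -> L2 g1 -> L2 g2 ->
  ae_eq mu D f1 f2 -> ae_eq mu D g1 g2 -> ip f1 g1 = ip f2 g2.
Proof.
move=> /in_L2_measurable ? /in_L2_measurable ? /in_L2_measurable ?
  /in_L2_measurable ? f12 g12.
apply: ae_eq_Rintegral; [exact: measurable_funM|exact: measurable_funM|].
by apply: filterS2 f12 g12 => x h1 h2 Dx; rewrite h1// h2.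
Qed.

Lemma ae_eq_sq f g : L2 f -> L2 g -> ae_eq mu D f g -> sq f = sq g.
Proof.
move=> Lf Lg fg; under eq_Rintegral do rewrite expr2.
by under [RHS]eq_Rintegral do rewrite expr2; exact: ae_eq_ip.
Qed.

Lemma sq_eq0 f : L2 f -> sq f = 0 -> ae_eq mu D f (cst 0).
Proof.
move=> /in_L2P[mf f2] f0.
have mf2 : measurable_fun D (EFin \o (fun x => f x ^+ 2)) by exact: (measurable_int mu).
have : (\int[mu]_(x in D) `|(f x ^+ 2)%:E| = 0)%E.
  rewrite -[RHS](_ : (sq f)%:E = 0%E); last by rewrite f0.
  rewrite /Rintegral fineK; last exact: integrable_fin_num.
  by apply: eq_integral => x _; rewrite gee0_abs// lee_fin sqr_ge0.
move/(ae_eq_integral_abs mu mD mf2); apply: filterS => x /[apply] -[] /eqP.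
by rewrite sqrf_eq0 => /eqP.
Qed.

(** Multiplication by a bounded function is bounded on L^2. *)
Lemma in_L2_bounded M f g : measurable_fun D f ->
  {ae mu, forall x, D x -> `|f x| <= M} -> L2 g ->
  L2 (fun x => f x * g x) /\ sq (fun x => f x * g x) <= M ^+ 2 * sq g.
Proof.
move=> mf fM Lg; have [mg g2] := (in_L2P g).1 Lg.
have mfg2 : measurable_fun D (fun x => (f x * g x) ^+ 2).
  by apply: measurable_funX; exact: measurable_funM.
have M2 : {ae mu, forall x, D x -> ((f x * g x) ^+ 2)%:E <= (M ^+ 2 * g x ^+ 2)%:E}%E.
  apply: filterS fM => x h /h fMx; rewrite lee_fin exprMn ler_wpM2r ?sqr_ge0//.
  by rewrite -[leLHS]real_normK ?num_real// lerXn2r ?nnegrE// (le_trans _ fMx).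
have i2 : mu.-integrable D (fun x => (M ^+ 2 * g x ^+ 2)%:E).
  exact: (integrableZl mD (M ^+ 2) g2).
have le12 : (\int[mu]_(x in D) ((f x * g x) ^+ 2)%:E
    <= \int[mu]_(x in D) (M ^+ 2 * g x ^+ 2)%:E)%E.
  apply: ae_ge0_le_integral => //.
  - by move=> x _; rewrite lee_fin sqr_ge0.
  - exact/measurable_EFinP.
  - by move=> x _; rewrite lee_fin mulr_ge0 ?sqr_ge0.
  - exact: (measurable_int mu).
have fg2 : mu.-integrable D (EFin \o (fun x => (f x * g x) ^+ 2)).
  apply/integrableP; split; first exact/measurable_EFinP.
  under eq_integral => x _ do rewrite gee0_abs ?lee_fin ?sqr_ge0//.
  apply: le_lt_trans le12 _; exact: integrable_lty.
split; first by apply/in_L2P; split => //; exact: measurable_funM.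
rewrite -RintegralZl// fine_le// integrable_fin_num//.
Qed.

Hypothesis muD : (mu D < +oo)%E.

Lemma in_L2_cst s : L2 (cst s).
Proof.
apply/in_L2P; split => //.
apply: measurable_bounded_integrable => //.
  exact: (measurable_cst (s ^+ 2)).
exists `|s ^+ 2|; split; [exact: num_real|by move=> M sM x _ /=; exact: ltW].
Qed.

Lemma in_L2_integrable f : L2 f -> mu.-integrable D (EFin \o f).
Proof.
move=> Lf; apply: eq_integrable (in_L2_mul Lf (in_L2_cst 1)) => // x _.
by rewrite /= mulr1.
Qed.

Lemma in_L2_norm f : L2 f -> L2 (fun x => `|f x|).
Proof.
move=> /in_L2P[mf f2]; apply/in_L2P; split; first exact: measurableT_comp.
by under eq_fun do rewrite real_normK ?num_real//.
Qed.

(** Cauchy-Schwarz against the constant function 1. *)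
Lemma sqr_Rintegral_le f : L2 f ->
  (\int[mu]_(x in D) `|f x|) ^+ 2 <= fine (mu D) * sq f.
Proof.
move=> Lf; have := cauchy_schwarz_L2 (in_L2_norm Lf) (in_L2_cst 1).
under eq_Rintegral do rewrite mulr1.
under [in leRHS]eq_Rintegral do rewrite real_normK ?num_real//.
under [X in _ * X]eq_Rintegral do rewrite expr1n.
by rewrite Rintegral_cst// mul1r mulrC.
Qed.

(** Completeness of L^2.  A subsequence [f] with squared increments at most 4^-k
    has summable increments in L^1, hence converges almost everywhere to some
    [v]; by Fatou's lemma the whole sequence then converges to [v] in L^2. *)
Lemma riesz_fischer (u : nat -> X -> R) : (forall n, L2 (u n)) ->
  (forall e, 0 < e -> exists K, forall i j, (K <= i)%N -> (K <= j)%N ->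
     sq (fun x => u i x - u j x) <= e) ->
  exists2 v, L2 v & sq (fun x => u n x - v x) @[n --> \oo] --> (0 : R).
Proof.
move=> Lu cauchy.
have /choice[N0 HN0] : forall k : nat, exists K, forall i j, (K <= i)%N -> (K <= j)%N ->
    sq (fun x => u i x - u j x) <= (4 ^- k).
  by move=> k; apply: cauchy; rewrite invr_gt0 exprn_gt0.
pose N k := (k + \max_(l < k.+1) N0 l)%N.
have N0N k l : (k <= l)%N -> (N0 k <= N l)%N.
  move=> kl; have kl1 : (k < l.+1)%N by [].
  apply: leq_trans (leq_addl _ _); exact: (leq_bigmax (Ordinal kl1)).
pose f k := u (N k).
have Lf k : L2 (f k) by exact: Lu.
have mf k : measurable_fun D (f k) by exact: in_L2_measurable.
have Ldf k : L2 (fun x => f k.+1 x - f k x) by exact: in_L2B.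
(* By Young's inequality t <= 2^k t^2 / 2 + 2^-k / 2, the L^1 norm of the k-th
   increment is O(2^-k). *)
have df k : (\int[mu]_(x in D) `|f k.+1 x - f k x|%:E <=
    ((1 + fine (mu D)) / 2 * 2^-1 ^+ k)%:E)%E.
  have int2 := in_L2_sqr (Ldf k).
  have intn := in_L2_integrable (in_L2_norm (Ldf k)).
  rewrite -(fineK (integrable_fin_num mD intn)) lee_fin.
  apply: (@le_trans _ _ (\int[mu]_(x in D)
      (2 ^+ k / 2 * (f k.+1 x - f k x) ^+ 2 + 2^-1 ^+ k / 2))).
    apply: le_Rintegral => //.
      apply: integrableD_real; first exact: integrableZl_real.
      exact/in_L2_integrable/in_L2_cst.
    move=> x _ /=; rewrite -[_ ^+ 2 in leRHS]real_normK ?num_real//.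
    set t := `| _ |; have := sqr_ge0 (2 ^+ k * t - 1).
    have k0 : 0 < 2 ^+ k :> R by rewrite exprn_gt0.
    rewrite exprVn => h; rewrite -subr_ge0.
    have -> : 2 ^+ k / 2 * t ^+ 2 + (2 ^+ k)^-1 / 2 - t =
      (2 ^+ k * t - 1) ^+ 2 / (2 * 2 ^+ k) by field; rewrite gt_eqF.
    by rewrite divr_ge0// mulr_ge0// ltW.
  rewrite RintegralD//; [|exact: integrableZl_real|exact/in_L2_integrable/in_L2_cst].
  rewrite RintegralZl// Rintegral_cst//.
  have : sq (fun x => f k.+1 x - f k x) <= 4 ^- k by apply: HN0; exact: N0N.
  set a := Rintegral _ _ _; have -> : 4 ^- k = (2^-1 ^+ k) ^+ 2 :> R.
    by rewrite -exprM mulnC exprM exprVn -exprVn; congr (_ ^+ _); field.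
  move=> a4; have : 2 ^+ k / 2 * a <= 2 ^+ k / 2 * (2^-1 ^+ k) ^+ 2.
    by rewrite ler_wpM2l// divr_ge0// exprn_ge0.
  have -> : 2 ^+ k / 2 * (2^-1 ^+ k) ^+ 2 = 2^-1 ^+ k / 2 :> R.
    by rewrite exprVn; field; rewrite expf_neq0.
  by move=> ?; nra.
pose S x := (\sum_(k <oo) `|f k.+1 x - f k x|%:E)%E.
have mdf k : measurable_fun D (fun x => `|f k.+1 x - f k x|%:E).
  by apply/measurable_EFinP; apply: measurableT_comp => //; exact: measurable_funB.
have Sint : mu.-integrable D S.
  apply/integrableP; split.
    by apply: ge0_emeasurable_sum => // k x _ _; rewrite lee_fin.
  under eq_integral => x _ do rewrite gee0_abs ?nneseries_ge0//.
  rewrite integral_nneseries//.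
  apply: (@le_lt_trans _ _ (\sum_(k <oo) ((1 + fine (mu D)) / 2 * 2^-1 ^+ k)%:E)%E).
    apply: lee_nneseries => // k _ _; first by apply: integral_ge0 => x _; rewrite lee_fin.
  apply: (@le_lt_trans _ _ (1 + fine (mu D))%:E); last exact: ltry.
  apply: lime_le.
    by apply: is_cvg_nneseries => n _ _; rewrite lee_fin mulr_ge0// ?exprn_ge0// divr_ge0// addr_ge0// fine_ge0.
  apply: nearW => n; rewrite sumEFin lee_fin -mulr_sumr.
  have -> : \sum_(0 <= i < n) 2^-1 ^+ i = 2 - 2 * 2^-1 ^+ n :> R.
    elim: n => [|n IH]; first by rewrite big_nil expr0; ring.
    by rewrite big_nat_recr//= IH exprS; field.
  have : 0 <= 2^-1 ^+ n :> R by rewrite exprn_ge0.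
  have : 0 <= fine (mu D) by rewrite fine_ge0.
  nra.
have cvgf : {ae mu, forall x, D x -> cvgn (fun k => f k x)}.
  apply: filterS (integrable_ae mD Sint) => x /[apply] Sx.
  have tele : (fun k => f k x) = (fun n => f 0%N x + series (fun k => f k.+1 x - f k x) n).
    by apply/funext => n; rewrite -eq_sum_telescope.
  rewrite tele; apply: is_cvgD; first exact: is_cvg_cst.
  have nE n : [normed series (fun k => f k.+1 x - f k x)] n =
      \sum_(0 <= k < n) `|f k.+1 x - f k x| by rewrite /normed_series_of seriesEnat.
  apply: normed_cvg; apply: nondecreasing_is_cvgn.
    by apply/nondecreasing_seqP => n; rewrite !nE big_nat_recr//= lerDl.
  exists (fine (S x)) => _ [n _ <-].
  rewrite nE -lee_fin fineK// -sumEFin.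
  by apply: nneseries_lim_ge => k _ _; rewrite lee_fin.
(* The upper limit gives a measurable choice of the pointwise limit. *)
pose v x := fine (limn_esup (fun k => (f k x)%:E)).
have vE : {ae mu, forall x, D x -> f k x @[k --> \oo] --> v x}.
  apply: filterS cvgf => x /[apply] /cvg_ex[l fl].
  have /cvg_limn_einf_sup[_ El] : (f k x)%:E @[k --> \oo] --> l%:E by apply/fine_cvgP; split; [exact: nearW|exact: fl].
  by rewrite /v El/=; exact: fl.
have mv : measurable_fun D v.
  apply: measurableT_comp => //.
  by apply: measurable_fun_limn_esup => k; exact/measurable_EFinP.
have bound e : 0 < e -> exists K, forall n, (K <= n)%N ->
    (\int[mu]_(x in D) ((u n x - v x) ^+ 2)%:E <= e%:E)%E.
  move=> e0; have [K HK] := cauchy e e0; exists K => n Kn.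
  have mfn k : measurable_fun D (fun x => ((u n x - f k x) ^+ 2)%:E).
    by apply/measurable_EFinP/measurable_funX/measurable_funB => //; exact: in_L2_measurable.
  have fat := fatou mu mD mfn (fun k x _ => ltac:(by rewrite lee_fin sqr_ge0)).
  apply: le_trans (le_trans _ fat) _.
    apply: ae_ge0_le_integral => //.
    - by move=> x _; rewrite lee_fin sqr_ge0.
    - by apply/measurable_EFinP/measurable_funX/measurable_funB => //; exact: in_L2_measurable.
    - move=> x _; rewrite limn_einf_lim; apply: lime_ge; first exact: is_cvg_einfs.
      apply: nearW => k; apply: le_ereal_inf_tmp => _ [l _ <-].
      by rewrite lee_fin sqr_ge0.
    - rewrite (_ : (fun x => _) = (fun x => - limn_esup (-%E \o (fun k => ((u n x - f k x) ^+ 2)%:E)))%E).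
        apply: measurableT_comp => //; apply: measurable_fun_limn_esup => k.
        exact: measurableT_comp.
      by apply/funext => x; rewrite limn_esupN oppeK.
    - apply: filterS vE => x /[apply] fv.
      suff /cvg_limn_einf_sup[-> _] : ((u n x - f k x) ^+ 2)%:E @[k --> \oo]
        --> ((u n x - v x) ^+ 2)%:E by [].
      apply/fine_cvgP; split; first exact: nearW.
      rewrite /comp/=.
      rewrite !expr2; apply: cvgM; apply: cvgB => //; exact: cvg_cst.
  rewrite limn_einf_lim; apply: lime_le; first exact: is_cvg_einfs.
  exists K => // k /= Kk; apply: le_trans (ereal_inf_lbound _) _.
    by exists k => //=.
  have Lnk : L2 (fun x => u n x - f k x) by exact: in_L2B.
  rewrite -(fineK (integrable_fin_num mD (in_L2_sqr Lnk))) lee_fin.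
  apply: HK => //; apply: leq_trans Kk _; exact: leq_addr.
have Luv n K : (\int[mu]_(x in D) ((u n x - v x) ^+ 2)%:E <= K%:E)%E -> L2 (fun x => u n x - v x).
  move=> le; have muv : measurable_fun D (fun x => u n x - v x).
    by apply: measurable_funB => //; exact: in_L2_measurable.
  apply/in_L2P; split => //; apply/integrableP; split.
    exact/measurable_EFinP/measurable_funX.
  under eq_integral => x _ do rewrite gee0_abs ?lee_fin ?sqr_ge0//.
  exact: le_lt_trans le (ltry _).
exists v.
  have [K HK] := bound 1 ltr01; have Luv0 := Luv _ _ (HK K (leqnn K)).
  have := in_L2B (Lu K) Luv0; congr (in_Lp _ _ _ _).
  by apply/funext => x; rewrite opprB addrC subrK.
apply/cvgrPdist_le => e e0; have [K HK] := bound e e0; exists K => // n /= Kn.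
rewrite sub0r normrN ger0_norm ?sq_ge0// -lee_fin.
have := HK n Kn; rewrite /Rintegral fineK//.
exact/integrable_fin_num/in_L2_sqr/Luv/HK.
Qed.

End L2.

(** * Functions with zero weak derivative are constant *)

Section primitives.
Context {R : realType}.
Local Notation mu := (@lebesgue_measure R).
Implicit Types (a b : R) (psi : R -> R).

Lemma continuous_measurable_lebesgue psi (A : set (measurableTypeR R)) :
  measurable A -> continuous psi -> measurable_fun A psi.
Proof.
move=> mA cpsi; apply: measurable_funTS.
exact: (continuous_measurable_fun cpsi).
Qed.

Lemma continuous_support_integrable psi a b : continuous psi ->
  (forall x, x \notin `[a, b] -> psi x = 0) -> mu.-integrable setT (EFin \o psi).
Proof.
move=> cpsi psi0.
have i1 : mu.-integrable `[a, b]%classic (EFin \o psi).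
  apply: continuous_compact_integrable; first exact: segment_compact.
  exact: continuous_subspaceT.
have mab : measurable (`[a, b]%classic : set (measurableTypeR R)) by exact: measurable_itv.
have i2 : mu.-integrable setT ((EFin \o psi) \_ `[a, b]%classic).
  by apply/(integrable_mkcond _ mab).
have <- // : (EFin \o psi) \_ `[a, b]%classic = EFin \o psi.
apply/funext => x; rewrite /patch; case: ifPn => // /negP xab.
by rewrite /= psi0//; apply/negP => h; apply: xab; rewrite inE.
Qed.

Lemma Rintegral_supp psi (A B : set R) : (forall x, psi x != 0 -> (A x <-> B x)) ->
  \int[mu]_(x in A) psi x = \int[mu]_(x in B) psi x.
Proof.
move=> h; rewrite Rintegral_mkcond [RHS]Rintegral_mkcond.
congr (Rintegral _ _ _); apply/funext => x; rewrite /patch.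
have [->|/h AB] := eqVneq (psi x) 0; first by rewrite !if_same.
by rewrite (_ : (x \in A) = (x \in B))//; apply/idP/idP; rewrite !inE => /AB.
Qed.

Lemma Rintegral_eq0 psi (A : set R) : (forall x, A x -> psi x = 0) ->
  \int[mu]_(x in A) psi x = 0.
Proof. by move=> h; rewrite /Rintegral integral0_eq// => x /h ->. Qed.

Definition primitive psi (x : R) : R := \int[mu]_(t in `]-oo, x]%classic) psi t.

(** The mean-zero condition makes the primitive vanish to the right of the
    support of [psi]. *)
Lemma test_fun_primitive (T : R) psi a b : 0 < a -> b < T -> continuous psi ->
  (forall x, x \notin `[a, b] -> psi x = 0) ->
  \int[mu]_(t in `]0, T[%classic) psi t = 0 ->
  test_fun T (primitive psi) /\ (primitive psi)^`()%classic = psi.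
Proof.
move=> a0 bT cpsi psi0 int0.
have supp x : psi x != 0 -> a <= x <= b.
  by apply: contra_neqT => h; apply: psi0; rewrite in_itv.
have iT := continuous_support_integrable cpsi psi0.
have ftc x : derivable (primitive psi) x 1 /\ (primitive psi)^`()%classic x = psi x.
  apply: (@continuous_FTC1 _ psi -oo%O x (x + 1)) => //.
  - by rewrite ltrDl.
  - exact: integrableS iT.
  - by rewrite ltNyr.
  - exact: cpsi.
have dE : (primitive psi)^`()%classic = psi by apply/funext => x; case: (ftc x).
split => //; split; first by move=> x; case: (ftc x).
  by rewrite dE.
exists a, b; split => // x; rewrite in_itv/= negb_and -!ltNge => /orP[xa|bx].
  apply: Rintegral_eq0 => t /=; rewrite in_itv/= => tx; apply: psi0.
  by rewrite in_itv/= negb_and -ltNge (le_lt_trans tx xa).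
rewrite /primitive -[RHS]int0; apply: Rintegral_supp => t /supp /andP[at_ tb] /=.
rewrite !in_itv/= (le_trans tb (ltW bx)); split => // _.
by rewrite (lt_le_trans a0)// (le_lt_trans tb).
Qed.

End primitives.

Section trapezoid.
Context {R : realType}.
Local Notation mu := (@lebesgue_measure R).
Variables (a b : R).

(** Continuous approximations of the indicator function of ]a, b[ which vanish
    outside ]a, b[. *)
Definition trapezoid (n : nat) (x : R) : R :=
  Num.max 0 (Num.min 1 (n%:R * Num.min (x - a) (b - x))).

Lemma trapezoid_itv n x : 0 <= trapezoid n x <= 1.
Proof. by rewrite /trapezoid le_max lexx/= ge_max ler01/= ge_min lexx. Qed.

Lemma continuous_trapezoid n : continuous (trapezoid n).
Proof.
have -> : trapezoid n = (cst 0 \max (cst 1 \min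
    (fun x => n%:R * ((fun x => x - a) \min (fun x => b - x)) x))) by [].
move=> x; apply: continuous_max; first exact: cvg_cst.
apply: continuous_min; first exact: cvg_cst.
apply: cvgM; first exact: cvg_cst.
apply: continuous_min.
  by apply: cvgB; [exact: cvg_id|exact: cvg_cst].
by apply: cvgB; [exact: cvg_cst|exact: cvg_id].
Qed.

Lemma trapezoid_out n x : x \notin `]a, b[ -> trapezoid n x = 0.
Proof.
rewrite in_itv/= negb_and -!leNgt => h; apply/max_idPl.
rewrite ge_min; apply/orP; right; rewrite mulr_ge0_le0// ge_min !subr_le0.
by apply/orP; case: h => /orP[->|->]; [left|right].
Qed.

Lemma cvg_trapezoid x : trapezoid n x @[n --> \oo] --> (\1_`]a, b[%classic x : R).
Proof.
rewrite indicE; case: (boolP (x \in `]a, b[)) => xab; last first.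
  rewrite memNset; last by move=> h; move/negP: xab; apply.
  under eq_fun do rewrite trapezoid_out//.
  exact: cvg_cst.
rewrite mem_set//; set m := Num.min (x - a) (b - x).
have m0 : 0 < m by move: xab; rewrite in_itv/= => /andP[? ?]; rewrite lt_min !subr_gt0; apply/andP.
apply: cvg_near_cst; exists (Num.bound m^-1) => // n /= nm.
rewrite /trapezoid -/m (min_idPl _).
  by apply/max_idPr.
rewrite -ler_pdivrMr// div1r.
apply: (le_trans (ltW (archi_boundP _))); first by rewrite invr_ge0 ltW.
by rewrite ler_nat.
Qed.

End trapezoid.

Section du_bois_reymond.
Context {R : realType} (T : R).
Local Notation mu := (@lebesgue_measure R).
Local Notation D := (`]0, T[%classic : set (measurableTypeR R)).
Implicit Types (a b : R) (f : R -> R).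
Let mD : measurable D. Proof. exact: measurable_itv. Qed.
Let muD : (mu D < +oo)%E.
Proof. by rewrite /= lebesgue_measure_itv/=; case: ifP => // _; rewrite -EFinB ltry. Qed.

Lemma integrableM_trapezoid n a b f : mu.-integrable D (EFin \o f) ->
  mu.-integrable D (EFin \o (fun x => f x * trapezoid a b n x)).
Proof.
move=> fi; apply: (le_integrable mD _ _ fi).
  apply/measurable_EFinP/measurable_funM.
    by apply/measurable_EFinP; exact: (measurable_int mu fi).
  exact: (continuous_measurable_lebesgue mD (@continuous_trapezoid _ _ _ _)).
move=> x _ /=; rewrite lee_fin normrM ler_piMr// ger0_norm//; by case/andP: (trapezoid_itv a b n x).
Qed.

Lemma cvg_Rintegral_trapezoid f a b : mu.-integrable D (EFin \o f) ->
  0 < a -> b < T ->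
  \int[mu]_(x in D) (f x * trapezoid a b n x) @[n --> \oo] -->
  \int[mu]_(x in `]a, b[%classic) f x.
Proof.
move=> fi a0 bT.
have mf : measurable_fun D f by apply/measurable_EFinP; exact: (measurable_int mu).
have sub : `]a, b[%classic `<=` D by apply: subset_itv; rewrite bnd_simp ltW.
rewrite (_ : \int[mu]_(x in `]a, b[%classic) f x =
    \int[mu]_(x in D) (f x * \1_`]a, b[%classic x)); last first.
  rewrite Rintegral_mkcond [RHS]Rintegral_mkcond; congr (Rintegral _ _ _).
  apply/funext => x; rewrite /patch indicE.
  case: ifPn => [xab|]; last by rewrite mulr0 if_same.
  by rewrite mulr1 mem_set//; apply: sub; rewrite inE in xab.
have mt n : measurable_fun D (fun x => f x * trapezoid a b n x).
  apply: measurable_funM => //; apply: measurable_funTS.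
  exact: continuous_measurable_lebesgue (@continuous_trapezoid R a b n).
apply: (@cvg_Rintegral _ _ _ mu D mD _ _ (fun x => `|f x|)) => //.
- by apply: measurable_funM => //; exact: measurable_indic.
- by move=> x _; apply: cvgM; [exact: cvg_cst|exact: cvg_trapezoid].
- exact: integrable_norm.
- move=> n x _; rewrite normrM ler_piMr// ger0_norm; by case/andP: (trapezoid_itv a b n x).
Qed.

(** Lebesgue's differentiation theorem: an integrable function is almost
    everywhere the derivative of its primitive. *)
Lemma locally_cst_primitive g : mu.-integrable setT (EFin \o g) ->
  (forall u v, D u -> D v -> u < v -> primitive g u = primitive g v) ->
  ae_eq mu D g (cst 0).
Proof.
move=> gi gcst.
have giS y : mu.-integrable `]-oo, y]%classic (EFin \o g).
  by apply: (integrableS measurableT _ _ gi) => //; exact: measurable_itv.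
have := @FTC1Ny R g giS.
move=> /(_ (open_integrable_locally openT gi)).
apply: filterS; first exact: (ae_filter_ringOfSetsType mu).
move=> x [_ dF] xD; rewrite -dF.
rewrite -[RHS](derive1_cst (primitive g x) x) !derive1E; apply: near_eq_derive.
have gx y : D y -> primitive g y = primitive g x.
  move=> yD; have [xy|yx|->//] := ltgtP x y; last exact: gcst.
  by rewrite (gcst x y).
have : \forall y \near x, D y by apply: open_nbhs_nbhs; split; [exact: interval_open|].
by apply: filterS => y yD; exact: gx.
Qed.

(** Combinations of two trapezoids with mean zero are derivatives of test
    functions, so in the limit the integral of [f] over ]a, b[ is proportional
    to b - a.  Hence all integrals of f - c over subintervals vanish for a
    suitable [c], and f = c almost everywhere. *)
Lemma du_bois_reymond f : 0 < T -> mu.-integrable D (EFin \o f) ->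
  (forall phi, test_fun T phi ->
     \int[mu]_(t in D) (f t * phi^`()%classic t) = 0) ->
  exists c, ae_eq mu D f (cst c).
Proof.
move=> T0 fi f0.
(* Any fixed subinterval serves as the reference determining the constant. *)
pose a1 := T / 4; pose b1 := 3 * T / 4.
have a1b1 : [/\ 0 < a1, a1 < b1 & b1 < T] by split; rewrite /a1 /b1; lra.
have ic s : mu.-integrable D (EFin \o cst s).
  exact: (in_L2_integrable mD muD (in_L2_cst mD muD s)).
have i1 := ic 1.
have ab a b : 0 < a -> a < b -> b < T ->
    (b1 - a1) * \int[mu]_(x in `]a, b[%classic) f x =
    (b - a) * \int[mu]_(x in `]a1, b1[%classic) f x.
  move=> a0 lt_ab bT.
  have lenE u v : u < v -> \int[mu]_(x in `]u, v[%classic) (cst 1 x : R) = v - u.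
    move=> uv; rewrite Rintegral_cst; last exact: measurable_itv.
    by rewrite mul1r /= lebesgue_measure_itv/= lte_fin uv -EFinB.
  have [a10 a1b1' b1T] := a1b1.
  have c1 := cvg_Rintegral_trapezoid fi a0 bT.
  have c2 := cvg_Rintegral_trapezoid fi a10 b1T.
  have c3 := cvg_Rintegral_trapezoid i1 a0 bT.
  have c4 := cvg_Rintegral_trapezoid i1 a10 b1T.
  rewrite lenE// in c3; rewrite lenE// in c4.
  (* It suffices to prove the proportionality with the trapezoids in place of
     the indicator functions, for each n. *)
  apply: (cvg_unique (@Rhausdorff R) (cvgM c4 c1)).
  rewrite (_ : _ \* _ = (fun n => \int[mu]_(x in D) ((cst 1 x : R) * trapezoid a b n x))
    \* (fun n => \int[mu]_(x in D) (f x * trapezoid a1 b1 n x))); first exact: cvgM c3 c2.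
  apply/funext => n /=.
  set be := (X in X * _ = _); set al := (X in _ = X * _).
  pose psi x := be * trapezoid a b n x - al * trapezoid a1 b1 n x.
  have itr u v : mu.-integrable D (EFin \o trapezoid u v n).
    apply: (le_integrable mD _ _ i1) => [|x _ /=].
      apply/measurable_EFinP.
      exact: (continuous_measurable_lebesgue mD (@continuous_trapezoid _ _ _ _)).
    by rewrite lee_fin normr1 ger0_norm; case/andP: (trapezoid_itv u v n x).
  have [tpsi dpsi] : test_fun T (primitive psi) /\ (primitive psi)^`()%classic = psi.
    apply: (@test_fun_primitive _ _ _ (Num.min a a1) (Num.max b b1)).
    - by rewrite lt_min a0.
    - by rewrite gt_max bT.
    - move=> x; apply: cvgB; apply: cvgM; do ?exact: cvg_cst; exact: continuous_trapezoid.
    - move=> x; rewrite in_itv/= negb_and -!ltNge => h.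
      rewrite /psi !trapezoid_out ?mulr0 ?subr0//; rewrite in_itv/= negb_and -!leNgt.
        by case/orP: h; [rewrite lt_min => /andP[_ /ltW->]|rewrite gt_max => /andP[_ /ltW->]]; rewrite ?orbT.
      by case/orP: h; [rewrite lt_min => /andP[/ltW->]|rewrite gt_max => /andP[/ltW->]]; rewrite ?orbT.
    - transitivity (be * al - al * be); last by rewrite mulrC subrr.
      rewrite /psi RintegralB//; [|exact/integrableZl_real/itr|exact/integrableZl_real/itr].
      rewrite !RintegralZl//; do ?exact: itr.
      by rewrite /al /be; congr (_ * _ - _ * _); apply: eq_Rintegral => x _; rewrite mul1r.
  have := f0 _ tpsi; rewrite dpsi.
  rewrite (_ : \int[mu]_(t in D) (f t * psi t) = \int[mu]_(t in D)
    (be * (f t * trapezoid a b n t) - al * (f t * trapezoid a1 b1 n t))); last first.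
    by apply: eq_Rintegral => x _; rewrite /psi; ring.
  rewrite RintegralB//; [|exact/integrableZl_real/integrableM_trapezoid|exact/integrableZl_real/integrableM_trapezoid].
  rewrite !RintegralZl//; do ?exact: integrableM_trapezoid.
  by move/eqP; rewrite subr_eq0 => /eqP.
pose c := (\int[mu]_(x in `]a1, b1[%classic) f x) / (b1 - a1).
have fc a b : 0 < a -> a < b -> b < T -> \int[mu]_(x in `]a, b[%classic) (f x - c) = 0.
  move=> a0 lt_ab bT; have [a10 a1b1' b1T] := a1b1.
  have sub : `]a, b[%classic `<=` D by apply: subset_itv; rewrite bnd_simp ltW.
  have mab : measurable (`]a, b[%classic : set (measurableTypeR R)) by exact: measurable_itv.
  rewrite RintegralB//; [|exact: integrableS fi|exact: (@integrableS _ _ _ mu D _ _ mD mab sub (ic c))].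
  rewrite Rintegral_cst//= lebesgue_measure_itv/= lte_fin lt_ab -EFinB/= /c.
  by rewrite mulrAC [X in _ - X / _]mulrC -ab// [X in _ - X / _]mulrC mulfK ?subrr// subr_eq0 gt_eqF.
exists c; pose g := (fun x => f x - c) \_ D.
have gi : mu.-integrable setT (EFin \o g).
  rewrite (_ : EFin \o g = (EFin \o (fun x => f x - c)) \_ D); last first.
    by apply/funext => x; rewrite /= /g /patch; case: ifPn.
  apply/(integrable_mkcond _ mD); apply: integrableD_real => //.
  exact: (ic (- c)).
have : ae_eq mu D g (cst 0).
  apply: (locally_cst_primitive gi) => u v uD vD uv.
  apply/esym/eqP; rewrite -subr_eq0; apply/eqP.
  have giS A : measurable A -> mu.-integrable A (EFin \o g).
    by move=> mA; exact: integrableS gi.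
  rewrite /primitive Rintegral_itvB; [|apply: giS; exact: measurable_itv|by rewrite ?bnd_simp|by rewrite bnd_simp ltW].
  rewrite -Rintegral_itv_bndo_bndc; last by apply: giS; exact: measurable_itv.
  move: uD vD; rewrite /= !in_itv/= => /andP[u0 uT] /andP[v0 vT].
  rewrite -[RHS](fc u v)//; apply: eq_Rintegral => t; rewrite inE/= in_itv/= => /andP[ut tv].
  by rewrite /g patchE mem_set//= in_itv/= (lt_trans u0) ?(lt_trans tv).
apply: filterS => x /[swap] xD /(_ xD).
by rewrite /g patchE mem_set// => /eqP; rewrite subr_eq0 => /eqP.
Qed.

End du_bois_reymond.

(** * Weak derivatives on an interval *)

Section weak_derivatives.
Context {R : realType} (T : R).
Hypothesis T_gt0 : 0 < T.
Local Notation mu := (@lebesgue_measure R).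
Local Notation D := (`]0, T[%classic : set (measurableTypeR R)).
Local Notation ip f g := (\int[mu]_(x in D) (f x * g x)).
Local Notation sq f := (\int[mu]_(x in D) (f x ^+ 2)).
Implicit Types (f g h u v w phi : R -> R) (s : R).

Lemma measurable_oo : measurable D. Proof. exact: measurable_itv. Qed.

Lemma mu_oo : mu D = T%:E.
Proof. by rewrite /= lebesgue_measure_itv/= lte_fin T_gt0 -EFinB subr0. Qed.

Let mD := measurable_oo.
Let muD : (mu D < +oo)%E. Proof. by rewrite mu_oo ltry. Qed.

Lemma L2_continuous f : {within `[0, T]%classic, continuous f} -> L2 T f.
Proof.
move=> cf; apply/(in_L2P mu mD).
have sub : D `<=` `[0, T]%classic by apply: subset_itv; rewrite bnd_simp.
have mcc : measurable (`[0, T]%classic : set (measurableTypeR R)) by exact: measurable_itv.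
split.
  by apply: (measurable_funS mcc sub); exact: (subspace_continuous_measurable_fun mcc cf).
apply: (integrableS mcc mD sub); apply: continuous_compact_integrable.
  exact: segment_compact.
move=> x; rewrite /GRing.exp/=; apply: cvgM; exact: cf.
Qed.

Lemma test_fun_continuous phi : test_fun T phi -> continuous phi.
Proof. by case=> dphi _ _ x; apply: differentiable_continuous; apply/derivable1_diffP; exact: dphi. Qed.

Lemma test_fun_L2 phi : test_fun T phi -> L2 T phi /\ L2 T phi^`()%classic.
Proof.
move=> tphi; split; apply: L2_continuous; apply: continuous_subspaceT.
  exact: test_fun_continuous.
by case: tphi.
Qed.

Lemma weak_deriv_axpy s u v g h : L2 T u -> L2 T v -> L2 T g -> L2 T h ->
  is_weak_deriv T u g -> is_weak_deriv T v h ->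
  is_weak_deriv T (fun x => u x + s * v x) (fun x => g x + s * h x).
Proof.
move=> Lu Lv Lg Lh ug vh phi tphi; have [Lphi Ldphi] := test_fun_L2 tphi.
rewrite (ip_axpy mD s Lu Lv Ldphi) (ip_axpy mD s Lg Lh Lphi) ug// vh//; ring.
Qed.

Lemma cvg_ip (un : nat -> R -> R) u h : (forall n, L2 T (un n)) -> L2 T u ->
  L2 T h -> sq (fun x => un n x - u x) @[n --> \oo] --> (0 : R) ->
  ip (un n) h @[n --> \oo] --> ip u h.
Proof.
move=> Lun Lu Lh cvu.
have Ld n : L2 T (fun x => un n x - u x) by exact: (in_L2B mD (Lun n) Lu).
have E n : ip (un n) h = ip u h + ip (fun x => un n x - u x) h.
  have := ip_axpy mD 1 Lu (Ld n) Lh; rewrite mul1r => <-.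
  by apply: eq_Rintegral => x _; congr (_ * _); ring.
rewrite (funext E) -[X in _ --> X]addr0; apply: cvgD; first exact: cvg_cst.
apply/norm_cvg0P.
apply: (@squeeze_cvgr _ _ _ _ (cst 0) (fun n => Num.sqrt (sq (fun x => un n x - u x) * sq h))).
- apply: nearW => n; rewrite normr_ge0/= -sqrtr_sqr ler_sqrt ?mulr_ge0 ?sq_ge0//.
  exact: (cauchy_schwarz_L2 mD (Ld n) Lh).
- exact: cvg_cst.
rewrite -[X in _ --> X](sqrtr0 R).
apply: (@continuous_cvg _ _ _ _ _ _ Num.sqrt); first exact: sqrt_continuous.
by rewrite -[X in _ --> X](mul0r (sq h)); apply: cvgM => //; exact: cvg_cst.
Qed.

(** Both sides of the defining identity are inner products with a fixed test
    function, hence continuous in L^2. *)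
Lemma weak_deriv_lim (un gn : nat -> R -> R) u g :
  (forall n, L2 T (un n)) -> L2 T u -> (forall n, L2 T (gn n)) -> L2 T g ->
  sq (fun x => un n x - u x) @[n --> \oo] --> (0 : R) ->
  sq (fun x => gn n x - g x) @[n --> \oo] --> (0 : R) ->
  (forall n, is_weak_deriv T (un n) (gn n)) -> is_weak_deriv T u g.
Proof.
move=> Lun Lu Lgn Lg cu cg wd phi tphi; have [Lphi Ldphi] := test_fun_L2 tphi.
have c1 := cvg_ip Lun Lu Ldphi cu; have c2 := cvgN (cvg_ip Lgn Lg Lphi cg).
apply: (cvg_unique (@Rhausdorff R) c1).
have E : (fun n => ip (un n) phi^`()%classic) = - (fun n => ip (gn n) phi).
  by apply/funext => n /=; exact: wd.
by rewrite E; exact: c2.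
Qed.

Local Notation prim g := (primitive (g \_ D)).

Lemma prim_int0 g t : prim g t = \int[mu]_(s in `[0, t]%classic) (g \_ D) s.
Proof.
apply: Rintegral_supp => x; rewrite patchE; case: ifPn; last by rewrite eqxx.
by rewrite inE/= !in_itv/= => /andP[x0 _] _; rewrite (ltW x0).
Qed.

Lemma integrable_patch g : L2 T g -> mu.-integrable setT (EFin \o (g \_ D)).
Proof.
move=> /(in_L2_integrable mD muD)/(integrable_mkcond _ mD).
by congr (integrable _ _ _); apply/funext => x; rewrite /= /patch; case: ifPn.
Qed.

Lemma prim_continuous g : L2 T g -> {within `[0, T]%classic, continuous (prim g)}.
Proof.
move=> Lg; rewrite (_ : prim g = fun t => parameterized_integral mu 0 t (g \_ D)); last first.
  by apply/funext => t; rewrite prim_int0.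
apply: parameterized_integral_continuous; first exact: ltW.
apply: (integrableS measurableT); [exact: measurable_itv|by []|exact: integrable_patch].
Qed.

(** A test function vanishes at T. *)
Lemma test_fun_FTC phi t : test_fun T phi -> 0 <= t < T ->
  \int[mu]_(x in `[t, T]%classic) phi^`()%classic x = - phi t.
Proof.
move=> tphi /andP[t0 tT].
have [dphi cphi [a [b [a0 bT phi0]]]] := tphi.
have phiT : phi T = 0 by apply: phi0; rewrite in_itv/= negb_and -!ltNge bT orbT.
have cvphi := test_fun_continuous tphi.
have e : (\int[mu]_(x in `[t, T]) (phi^`()%classic x)%:E = (phi T)%:E - (phi t)%:E)%E.
  apply: (continuous_FTC2 tT); [exact: continuous_subspaceT| |by []].
  split; first by move=> x _; exact: dphi.
    exact/cvg_at_right_filter/cvphi.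
  exact/cvg_at_left_filter/cvphi.
by rewrite -[RHS]sub0r -phiT -[RHS]/(fine ((phi T)%:E - (phi t)%:E)%E) -e.
Qed.

Lemma weak_deriv_cst (c : R) : is_weak_deriv T (cst c) (cst 0).
Proof.
move=> phi tphi; have [Lphi Ldphi] := test_fun_L2 tphi.
rewrite RintegralZl//; last exact: in_L2_integrable.
rewrite [in RHS]Rintegral_eq0 ?oppr0; last by move=> x _; rewrite mul0r.
have idphi : mu.-integrable `[0, T]%classic (EFin \o phi^`()%classic).
  apply: continuous_compact_integrable; first exact: segment_compact.
  by apply: continuous_subspaceT; case: tphi.
have phi0 : phi 0 = 0.
  by case: tphi => _ _ [a [b [a0 bT phi0]]]; apply: phi0; rewrite in_itv/= leNgt a0.
have I0 : \int[mu]_(x in `[0, T]%classic) phi^`()%classic x = 0.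
  by rewrite test_fun_FTC ?lexx// phi0 oppr0.
have i1 : mu.-integrable `[0, T[%classic (EFin \o phi^`()%classic).
  by apply: (integrableS _ _ _ idphi) => //; apply: subset_itv; rewrite bnd_simp.
have -> : \int[mu]_(x in D) phi^`()%classic x = 0; last by rewrite mulr0.
rewrite Rintegral_itv_obnd_cbnd; last exact: in_L2_integrable.
by rewrite Rintegral_itv_bndo_bndc.
Qed.

(** Integration by parts for a primitive is Fubini's theorem on the triangle
    s <= t: integrating g(s) phi'(t) first in [t] produces -g(s) phi(s), first
    in [s] the primitive of [g] times phi'. *)
Lemma weak_deriv_primitive g : L2 T g -> is_weak_deriv T (prim g) g.
Proof.
move=> Lg phi tphi; have [Lphi Ldphi] := test_fun_L2 tphi.
pose p := phi^`()%classic.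
have ig := integrable_patch Lg; have ip := integrable_patch Ldphi.
have mg : measurable_fun setT (g \_ D) by apply/measurable_EFinP; exact: (measurable_int mu ig).
have mp : measurable_fun setT (p \_ D) by apply/measurable_EFinP; exact: (measurable_int mu ip).
pose A := [set z : measurableTypeR R * measurableTypeR R | z.1 <= z.2].
pose F (z : measurableTypeR R * measurableTypeR R) :=
  ((g \_ D) z.1 * ((p \_ D) z.2 * \1_A z))%:E.
have mA : measurable A.
  rewrite (_ : A = (fun z => z.2 - z.1) @^-1` `[0, +oo[%classic); last first.
    by apply/seteqP; split=> z /=; rewrite in_itv/= andbT subr_ge0.
  rewrite -[X in measurable X]setTI.
  have : measurable_fun setT (fun z : measurableTypeR R * measurableTypeR R => z.2 - z.1 : R).
    by apply: measurable_funB; [exact: measurable_snd|exact: measurable_fst].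
  by apply => //; exact: measurable_itv.
have mF : measurable_fun setT F.
  apply/measurable_EFinP; apply: measurable_funM.
    exact: measurableT_comp mg measurable_fst.
  apply: measurable_funM; last exact: measurable_indic.
  exact: measurableT_comp mp measurable_snd.
have iF : (mu \x mu)%E.-integrable setT F.
  apply/(@integrable12ltyP _ _ _ _ _ mu mu F mF).
  pose Ip := \int[mu]_t `|(p \_ D) t|.
  have iIp := integrableZl_real measurableT Ip (integrable_norm ig).
  apply: (le_lt_trans _ (integrable_lty measurableT iIp)).
  apply: ge0_le_integral => //.
  - by move=> s _; exact: integral_ge0.
  - apply: (measurable_fun_fubini_tonelli_F (abse \o F)) => //=.
    exact: measurableT_comp.
  - exact: (measurable_int mu iIp).
  move=> s _; have mFs : measurable_fun setT (fun t => F (s, t)).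
    exact: (measurableT_comp mF (pair1_measurable s)).
  rewrite /= mulrC EFinM (EFin_Rintegral measurableT); last exact: integrable_norm.
  rewrite -ge0_integralZl//=; last by apply/measurable_EFinP/measurableT_comp.
  apply: ge0_le_integral => //.
  - exact: (measurableT_comp (@abse_measurable R setT) mFs).
  - by apply: measurable_funeM; apply/measurable_EFinP/measurableT_comp.
  move=> t _; rewrite /F /= -EFinM lee_fin !normrM ler_wpM2l// ler_piMr//.
  by rewrite indicE; case: (_ \in _) => /=; rewrite ?normr1 ?normr0.
have E1 s : (\int[mu]_t F (s, t) = (((fun s => -1 * (g s * phi s)) \_ D) s)%:E)%E.
  rewrite patchE; case: ifPn => [|sD]; last first.
    by apply: integral0_eq => t _; rewrite /F /= patchE (negbTE sD) mul0r.
  rewrite inE => sD; have := sD; rewrite /= in_itv/= => /andP[s0 sT].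
  have ms : measurable (`[s, T[%classic : set (measurableTypeR R)) by exact: measurable_itv.
  have subs : `[s, T[%classic `<=` D by apply: subset_itv; rewrite bnd_simp.
  have ips : mu.-integrable `[s, T[%classic (EFin \o p).
    by apply: (integrableS mD ms subs); exact: in_L2_integrable.
  rewrite (_ : (fun t => F (s, t)) = (EFin \o (fun t => g s * p t)) \_ `[s, T[%classic); last first.
    apply/funext => t; rewrite /F /= !patchE mem_set// indicE.
    case: ifPn => [tD|].
      rewrite (_ : ((s, t) \in A) = (t \in `[s, T[%classic)).
        by case: ifPn => _ /=; rewrite ?mulr1 ?mulr0.
      move: tD; rewrite inE/= in_itv/= => /andP[t0 tT].
      by apply/idP/idP; rewrite !inE/= in_itv/= ?tT ?andbT.
    by move=> /negP tD; rewrite mul0r mulr0; case: ifPn => //; rewrite inE => /subs/mem_set.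
  rewrite -integral_mkcond -(EFin_Rintegral ms); last exact: integrableZl_real.
  rewrite RintegralZl//= Rintegral_itv_bndo_bndc//.
  by rewrite (test_fun_FTC tphi) ?(ltW s0)// mulrN mulN1r.
have E2 t : (\int[mu]_s F (s, t) = (((fun t => prim g t * p t) \_ D) t)%:E)%E.
  rewrite patchE; case: ifPn => [|tD]; last first.
    by apply: integral0_eq => s _; rewrite /F /= [(p \_ D) t]patchE (negbTE tD) mul0r mulr0.
  rewrite inE => tD; have := tD; rewrite /= in_itv/= => /andP[t0 tT].
  have mt : measurable (`]-oo, t]%classic : set (measurableTypeR R)) by exact: measurable_itv.
  have igt : mu.-integrable `]-oo, t]%classic (EFin \o (g \_ D)) by exact: (integrableS measurableT).
  rewrite (_ : (fun s => F (s, t)) = (EFin \o (fun s => p t * (g \_ D) s)) \_ `]-oo, t]%classic); last first.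
    apply/funext => s; rewrite /F /= [(p \_ D) t]patchE mem_set// indicE [RHS]patchE.
    rewrite (_ : ((s, t) \in A) = (s \in `]-oo, t]%classic)).
      by case: ifPn => _ /=; rewrite ?mulr1 ?mulr0 1?mulrC.
    by apply/idP/idP; rewrite !inE/= ?in_itv/=.
  rewrite -integral_mkcond -(EFin_Rintegral mt); last exact: integrableZl_real.
  by rewrite RintegralZl// mulrC.
have := congr1 fine (Fubini iF).
under eq_integral do rewrite E1.
under [in X in _ = X -> _]eq_integral do rewrite E2.
rewrite -![fine _]/(Rintegral _ _ _) -!Rintegral_mkcond => <-.
by rewrite RintegralZl ?mulN1r//; exact: in_L2_mul.
Qed.

End weak_derivatives.

(** * Continuous representatives, traces and membership in H^2 *)

Section sobolev_theory.
Context {R : realType} (T : R).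
Hypothesis T_gt0 : 0 < T.
Local Notation mu := (@lebesgue_measure R).
Local Notation D := (`]0, T[%classic : set (measurableTypeR R)).
Local Notation ip f g := (\int[mu]_(x in D) (f x * g x)).
Local Notation sq f := (\int[mu]_(x in D) (f x ^+ 2)).
Local Notation prim g := (primitive (g \_ D)).
Implicit Types (f g h u v w phi : R -> R) (s : R).

Let mD := @measurable_oo R T.
Let muD : (mu D < +oo)%E. Proof. by rewrite mu_oo// ltry. Qed.

Let ae_refl f : ae_eq mu D f f. Proof. exact: ae_eq_refl. Qed.

(** If the two functions differed at [x], they would differ on an interval, which
    has positive measure; [x] may be an end point of [0, T], hence the
    truncations by 0 and T. *)
Lemma ae_eq_continuous v w x :
  {within `[0, T]%classic, continuous v} -> {within `[0, T]%classic, continuous w} ->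
  ae_eq mu D v w -> 0 <= x <= T -> v x = w x.
Proof.
move=> cv cw [N [mN N0 vwN]] /andP[x0 xT]; apply: contrapT => /eqP vw.
have xA : `[0, T]%classic x by rewrite /= in_itv/= x0.
have cd : v y - w y @[y --> within `[0, T]%classic (nbhs x)] --> v x - w x.
  move/subspace_continuousP : cv => /(_ x xA) cv.
  by move/subspace_continuousP : cw => /(_ x xA) cw; exact: cvgB.
have : \forall y \near within `[0, T]%classic (nbhs x), v y - w y != 0.
  by apply: (cvgr_neq0 _ cd); rewrite subr_eq0.
rewrite near_withinE => -[e /= e0 He].
pose l := Num.max 0 (x - e); pose r := Num.min T (x + e).
have lr : l < r.
  rewrite /l /r lt_min !gt_max T_gt0 ltr_wpDl// ltrBlDr (le_lt_trans xT) ?ltrDl//=.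
  by rewrite ltrBlDr -addrA ltrDl addr_gt0.
have sub : `]l, r[%classic `<=` N.
  move=> y; rewrite /= in_itv/= /l /r gt_max lt_min -!andbA => /and4P[y0 xy yT yx].
  apply: vwN => /=; rewrite in_itv/= y0 yT => /(_ isT) vwy.
  have yA : y \in `[0, T] by rewrite in_itv/= !ltW.
  have /He/(_ yA) : ball_ Num.norm x e y by rewrite /ball_/= ltr_distlC xy.
  by rewrite vwy subrr eqxx.
have : (mu `]l, r[%classic <= mu N)%E by apply: le_measure => //; rewrite inE//; exact: measurable_itv.
rewrite N0 lebesgue_measure_itv/= lte_fin lr -EFinB lee_fin; lra.
Qed.

Lemma prim_L2 g : L2 T g -> L2 T (prim g).
Proof. by move=> Lg; exact/L2_continuous/prim_continuous. Qed.

Lemma weak_deriv0_cst f : L2 T f -> is_weak_deriv T f (cst 0) ->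
  exists c, ae_eq mu D f (cst c).
Proof.
move=> Lf wf; apply: du_bois_reymond => //; first exact: in_L2_integrable.
by move=> phi tphi; rewrite wf// Rintegral_eq0 ?oppr0// => x _; rewrite mul0r.
Qed.

(** The primitive of g - h has weak derivative g - h and, by hypothesis, also
    weak derivative 0; so it is constant, and its integrand vanishes. *)
Lemma weak_deriv_unique v g h : L2 T v -> L2 T g -> L2 T h ->
  is_weak_deriv T v g -> is_weak_deriv T v h -> ae_eq mu D g h.
Proof.
move=> Lv Lg Lh vg vh.
pose k x := g x + -1 * h x; have Lk : L2 T k by exact: in_L2_axpy.
have [|c kc] := weak_deriv0_cst (prim_L2 Lk).
  move=> phi tphi; rewrite weak_deriv_primitive//; congr (- _).
  have [Lphi _] := test_fun_L2 tphi.
  rewrite /k ip_axpy// mulN1r; have := vg _ tphi; rewrite vh// => /eqP.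
  rewrite eqr_opp => /eqP ->; rewrite subrr Rintegral_eq0// => x _; exact: mul0r.
have kc' x : 0 <= x <= T -> prim k x = c.
  apply: (@ae_eq_continuous _ (cst c)) kc; first exact: prim_continuous.
  by apply: continuous_subspaceT => ?; exact: cvg_cst.
have : ae_eq mu D (k \_ D) (cst 0).
  apply: locally_cst_primitive; first exact: integrable_patch.
  by move=> a b; rewrite /= !in_itv/= => /andP[? ?] /andP[? ?] _; rewrite !kc'// !ltW.
apply: filterS => x /[swap] xD /(_ xD); rewrite patchE mem_set// /k/= mulN1r.
by move/eqP; rewrite subr_eq0 => /eqP.
Qed.

Lemma weak_deriv_ae u v g h : L2 T u -> L2 T v -> L2 T g -> L2 T h ->
  ae_eq mu D u v -> ae_eq mu D g h -> is_weak_deriv T u g -> is_weak_deriv T v h.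
Proof.
move=> Lu Lv Lg Lh uv gh ug phi tphi; have [Lphi Ldphi] := test_fun_L2 tphi.
rewrite -(ae_eq_ip mD Lu Lv Ldphi Ldphi uv (ae_refl _)) ug//; congr (- _).
exact: (ae_eq_ip mD Lg Lh Lphi Lphi gh (ae_refl _)).
Qed.

(** [v] minus the primitive of its weak derivative has weak derivative 0. *)
Lemma weak_deriv_cont v g : L2 T v -> L2 T g -> is_weak_deriv T v g ->
  exists c, ae_eq mu D (fun x => prim g x + c) v.
Proof.
move=> Lv Lg vg; have Lp := prim_L2 Lg.
pose k x := v x + -1 * prim g x; have Lk : L2 T k by exact: in_L2_axpy.
have [|c kc] := weak_deriv0_cst Lk.
  have := weak_deriv_axpy (-1) Lv Lp Lg Lg vg (weak_deriv_primitive T_gt0 Lg).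
  by congr (is_weak_deriv T _ _); apply/funext => x; rewrite mulN1r subrr.
exists c; apply: filterS kc => x /[apply]; rewrite /k/= mulN1r => <-.
by rewrite addrC subrK.
Qed.

Lemma H1_cont_repP v : H1 T v ->
  {within `[0, T]%classic, continuous (cont_rep T v)} /\ ae_eq mu D (cont_rep T v) v.
Proof.
move=> [Lv [g [Lg vg]]]; have [c pv] := weak_deriv_cont Lv Lg vg.
rewrite /cont_rep; apply: (@xgetPex _ (cst 0)
  [set w | {within `[0, T]%classic, continuous w} /\ ae_eq mu `]0, T[%classic w v]).
exists (fun x => prim g x + c); split => // x.
by apply: cvgD; [exact: prim_continuous|exact: cvg_cst].
Qed.

Lemma cont_rep_eq v w x : {within `[0, T]%classic, continuous w} ->
  ae_eq mu D w v -> 0 <= x <= T -> cont_rep T v x = w x.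
Proof.
move=> cw wv; have [cr rv] : {within `[0, T]%classic, continuous (cont_rep T v)} /\
    ae_eq mu D (cont_rep T v) v.
  rewrite /cont_rep; apply: (@xgetPex _ (cst 0)
    [set w | {within `[0, T]%classic, continuous w} /\ ae_eq mu `]0, T[%classic w v]).
  by exists w.
by apply: ae_eq_continuous => //; apply: (ae_eq_trans rv); exact: ae_eq_sym.
Qed.

Lemma cont_rep_axpy s u v x : H1 T u -> H1 T v -> 0 <= x <= T ->
  cont_rep T (fun x => u x + s * v x) x = cont_rep T u x + s * cont_rep T v x.
Proof.
move=> /H1_cont_repP[cu uu] /H1_cont_repP[cv vv] xT.
apply: (@cont_rep_eq _ (fun x => cont_rep T u x + s * cont_rep T v x)) => //.
  by move=> y; apply: cvgD; [exact: cu|apply: cvgM; [exact: cvg_cst|exact: cv]].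
by apply: filterS2 uu vv => y hu hv yD; rewrite hu// hv.
Qed.

(** Averaging over t the inequality w(T)^2 <= 2 w(t)^2 + 2 (w(T) - w(t))^2, where
    w is the continuous representative and |w(T) - w(t)| is at most the L^1 norm
    of the derivative. *)
Lemma trace_bound v g : L2 T v -> L2 T g -> is_weak_deriv T v g ->
  T * cont_rep T v T ^+ 2 <= 2 * sq v + 2 * T ^+ 2 * sq g.
Proof.
move=> Lv Lg vg; have [c pv] := weak_deriv_cont Lv Lg vg.
pose w x := prim g x + c.
have cw : {within `[0, T]%classic, continuous w}.
  by move=> x; apply: cvgD; [exact: prim_continuous|exact: cvg_cst].
have Lw := L2_continuous cw.
rewrite (cont_rep_eq cw pv); last by rewrite ltW// lexx.
rewrite -(ae_eq_sq mD Lw Lv pv).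
pose I := \int[mu]_(x in D) `|g x|.
have I2 : I ^+ 2 <= T * sq g.
  apply: (@le_trans _ _ (fine (mu D) * sq g)); first exact: sqr_Rintegral_le.
  by rewrite mu_oo.
have wI t : D t -> `|w T - w t| <= I.
  rewrite /= in_itv/= => /andP[t0 tT].
  have ig := integrable_patch T_gt0 Lg.
  have mtT : measurable (`]t, T]%classic : set (measurableTypeR R)) by exact: measurable_itv.
  rewrite /w opprD addrACA subrr addr0 /primitive Rintegral_itvB; last 3 first.
  - by apply: (integrableS measurableT _ _ ig) => //; exact: measurable_itv.
  - by rewrite ?bnd_simp.
  - by rewrite bnd_simp ltW.
  have igt : mu.-integrable `]t, T]%classic (EFin \o (g \_ D)).
    exact: (integrableS measurableT).
  apply: (le_trans (le_normr_Rintegral mtT igt)).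
  rewrite /I Rintegral_mkcond [leRHS]Rintegral_mkcond; apply: le_Rintegral => //.
  - have /(integrable_mkcond _ mtT) := integrable_norm igt.
    by congr (integrable _ _ _); apply/funext => x; rewrite /= /patch; case: ifPn.
  - have /(integrable_mkcond _ mD) := integrable_norm (in_L2_integrable mD muD Lg).
    by congr (integrable _ _ _); apply/funext => x; rewrite /= /patch; case: ifPn.
  move=> x _; rewrite !patchE; case: ifPn => _; case: ifPn => _ //=; rewrite ?normr0//; exact: normr_ge0.
have iw : mu.-integrable D (EFin \o (fun x => 2 * w x ^+ 2)).
  exact/integrableZl_real/in_L2_sqr.
have ic s : mu.-integrable D (EFin \o cst s) by exact/in_L2_integrable/in_L2_cst.
have step : \int[mu]_(x in D) (cst (w T ^+ 2) x : R) <= \int[mu]_(x in D) (2 * w x ^+ 2 + 2 * I ^+ 2).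
  apply: le_Rintegral => //; first by apply: integrableD_real => //; exact: ic.
  move=> x xD /=; have := wI x xD; rewrite ler_norml => /andP[? ?].
  have := sqr_ge0 (w T - 2 * w x); nra.
have cE k : \int[mu]_(x in D) (cst k x : R) = k * T.
  by rewrite Rintegral_cst//; congr (_ * _); transitivity (fine (mu D)) => //; rewrite mu_oo.
have E2 : \int[mu]_(x in D) (2 * w x ^+ 2 + 2 * I ^+ 2) = 2 * sq w + 2 * I ^+ 2 * T.
  rewrite RintegralD//; last exact: ic.
  by rewrite RintegralZl//; [congr (_ + _); exact: cE|exact: in_L2_sqr].
rewrite cE E2 in step; rewrite mulrC; apply: (le_trans step).
rewrite lerD2l -2!mulrA ler_wpM2l// [I ^+ 2 * T]mulrC (expr2 T) -mulrA.
by rewrite ler_wpM2l// ltW.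
Qed.

Lemma H1_wderivP v : H1 T v -> [/\ L2 T v, L2 T (wderiv T v) & is_weak_deriv T v (wderiv T v)].
Proof.
move=> [Lv ex]; have [] := @xgetPex _ (cst 0) [set g | L2 T g /\ is_weak_deriv T v g] ex.
by [].
Qed.

Lemma wderiv_ae v g : L2 T v -> L2 T g -> is_weak_deriv T v g ->
  ae_eq mu D (wderiv T v) g.
Proof.
move=> Lv Lg vg; have [|_ Lw vw] := @H1_wderivP v; first by split => //; exists g.
exact: weak_deriv_unique vw vg.
Qed.

(** The derivatives chosen in the definition of H^2 may be replaced by any others:
    they agree almost everywhere. *)
Lemma H2P v g h : L2 T v -> L2 T g -> L2 T h -> is_weak_deriv T v g ->
  is_weak_deriv T g h ->
  [/\ H2 T v, ae_eq mu D (wderiv T v) g & ae_eq mu D (wderiv T (wderiv T v)) h].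
Proof.
move=> Lv Lg Lh vg gh; have H1v : H1 T v by split => //; exists g.
have [_ Lw vw] := H1_wderivP H1v; have wg := wderiv_ae Lv Lg vg.
have wh : is_weak_deriv T (wderiv T v) h.
  exact: (weak_deriv_ae Lg Lw Lh Lh (ae_eq_sym wg) (ae_refl h) gh).
split => //; last exact: wderiv_ae.
by split => //; split => //; exists h.
Qed.

End sobolev_theory.

(** * The Hilbert space H^2(0, T; R^I) *)

(** The quadratic forms are locked, so that they are only compared through the
    algebraic identities below and never unfolded down to the integrals and the
    chosen weak derivatives. *)
HB.lock Definition sqL2 {R : realType} (T : R) (f : R -> R) : R :=
  \int[@lebesgue_measure R]_(x in `]0, T[%classic) (f x ^+ 2).

HB.lock Definition ipL2 {R : realType} (T : R) (f g : R -> R) : R :=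
  \int[@lebesgue_measure R]_(x in `]0, T[%classic) (f x * g x).

HB.lock Definition sqH2 {R : realType} (T : R) {I : finType} (V : I -> R -> R) : R :=
  \sum_m (sqL2 T (V m) + sqL2 T (wderiv T (V m)) + sqL2 T (wderiv T (wderiv T (V m)))).

Section sqL2_theory.
Context {R : realType} (T : R).
Hypothesis T_gt0 : 0 < T.
Local Notation mu := (@lebesgue_measure R).
Local Notation D := (`]0, T[%classic : set (measurableTypeR R)).
Implicit Types (f g : R -> R) (s : R).

Let mD := @measurable_oo R T.
Let muD : (mu D < +oo)%E. Proof. by rewrite mu_oo// ltry. Qed.

Lemma sqL2E f : sqL2 T f = \int[mu]_(x in D) (f x ^+ 2).
Proof. by rewrite sqL2.unlock. Qed.

Lemma ipL2E f g : ipL2 T f g = \int[mu]_(x in D) (f x * g x).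
Proof. by rewrite ipL2.unlock. Qed.

Lemma sqL2_ge0 f : 0 <= sqL2 T f.
Proof. by rewrite sqL2E; exact: sq_ge0. Qed.

Lemma sqL2_axpy s f g : L2 T f -> L2 T g ->
  sqL2 T (fun x => f x + s * g x) = sqL2 T f + 2 * s * ipL2 T f g + s ^+ 2 * sqL2 T g.
Proof. by move=> Lf Lg; rewrite !sqL2E ipL2E; exact: sq_axpy. Qed.

Lemma sqL2_ae f g : L2 T f -> L2 T g -> ae_eq mu D f g -> sqL2 T f = sqL2 T g.
Proof. by move=> Lf Lg fg; rewrite !sqL2E; exact: ae_eq_sq. Qed.

Lemma sqL2_eq0 f : L2 T f -> sqL2 T f = 0 -> ae_eq mu D f (cst 0).
Proof. by rewrite sqL2E; exact: sq_eq0. Qed.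

Lemma L2_complete (u : nat -> R -> R) : (forall n, L2 T (u n)) ->
  (forall e, 0 < e -> exists K, forall i j, (K <= i)%N -> (K <= j)%N ->
     sqL2 T (fun x => u i x - u j x) <= e) ->
  exists v, L2 T v /\ sqL2 T (fun x => u n x - v x) @[n --> \oo] --> (0 : R).
Proof.
move=> Lu cauchy; have [|v Lv cv] := @riesz_fischer _ _ _ mu D mD muD u Lu.
  move=> e e0; have [K HK] := cauchy e e0; exists K => i j Ki Kj.
  by rewrite -(sqL2E (fun x => u i x - u j x)); exact: HK.
exists v; split => //.
by rewrite (_ : (fun n => _) = (fun n => \int[mu]_(x in D) ((u n x - v x) ^+ 2)))//;
  apply/funext => n; rewrite sqL2E.
Qed.

Lemma weak_deriv_limL2 (un gn : nat -> R -> R) u g :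
  (forall n, L2 T (un n)) -> L2 T u -> (forall n, L2 T (gn n)) -> L2 T g ->
  sqL2 T (fun x => un n x - u x) @[n --> \oo] --> (0 : R) ->
  sqL2 T (fun x => gn n x - g x) @[n --> \oo] --> (0 : R) ->
  (forall n, is_weak_deriv T (un n) (gn n)) -> is_weak_deriv T u g.
Proof.
move=> Lun Lu Lgn Lg cu cg; apply: weak_deriv_lim => //.
  move: cu; rewrite (_ : (fun n => sqL2 _ _) = (fun n => \int[mu]_(x in D) ((un n x - u x) ^+ 2)))//.
  by apply/funext => n; rewrite sqL2E.
move: cg; rewrite (_ : (fun n => sqL2 _ _) = (fun n => \int[mu]_(x in D) ((gn n x - g x) ^+ 2)))//.
by apply/funext => n; rewrite sqL2E.
Qed.

Lemma trace_boundL2 v g : L2 T v -> L2 T g -> is_weak_deriv T v g ->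
  T * cont_rep T v T ^+ 2 <= 2 * sqL2 T v + 2 * T ^+ 2 * sqL2 T g.
Proof. by move=> Lv Lg vg; rewrite !sqL2E; exact: trace_bound. Qed.

End sqL2_theory.

Section H2_vector.
Context {R : realType} (T : R) {I : finType}.
Hypothesis T_gt0 : 0 < T.
Local Notation mu := (@lebesgue_measure R).
Local Notation D := (`]0, T[%classic : set (measurableTypeR R)).
Local Notation ip := (ipL2 T).
Local Notation sq := (sqL2 T).
Local Notation d1 := (wderiv T).
Local Notation d2 f := (wderiv T (wderiv T f)).
Implicit Types (u v : R -> R) (U V : I -> R -> R) (s : R).

Let mD := @measurable_oo R T.
Let muD : (mu D < +oo)%E. Proof. by rewrite mu_oo// ltry. Qed.

Lemma H2_wderivP v : H2 T v -> [/\ L2 T v, L2 T (d1 v), L2 T (d2 v),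
  is_weak_deriv T v (d1 v) & is_weak_deriv T (d1 v) (d2 v)].
Proof. by move=> [/H1_wderivP[? ? ?] /H1_wderivP[]]. Qed.

Lemma H2_axpy s u v : H2 T u -> H2 T v ->
  [/\ H2 T (fun x => u x + s * v x),
      ae_eq mu D (d1 (fun x => u x + s * v x)) (fun x => d1 u x + s * d1 v x)
    & ae_eq mu D (d2 (fun x => u x + s * v x)) (fun x => d2 u x + s * d2 v x)].
Proof.
move=> /H2_wderivP[Lu Lu1 Lu2 wu wu1] /H2_wderivP[Lv Lv1 Lv2 wv wv1].
exact: (H2P T_gt0 (in_L2_axpy mD s Lu Lv) (in_L2_axpy mD s Lu1 Lv1) (in_L2_axpy mD s Lu2 Lv2)
  (weak_deriv_axpy s Lu Lv Lu1 Lv1 wu wv) (weak_deriv_axpy s Lu1 Lv1 Lu2 Lv2 wu1 wv1)).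
Qed.

Lemma H2v_axpy s U V : H2v T U -> H2v T V -> H2v T (fun m x => U m x + s * V m x).
Proof. by move=> HU HV m; case: (H2_axpy s (HU m) (HV m)). Qed.

Lemma H2v_sub U V : H2v T U -> H2v T V -> H2v T (fun m x => U m x - V m x).
Proof.
move=> HU HV; have := H2v_axpy (-1) HU HV.
by congr (H2v T _); apply/funext => m; apply/funext => x; rewrite mulN1r.
Qed.

Lemma normL2_sqr V : normL2 T V ^+ 2 = \sum_m sq (V m).
Proof.
rewrite sqr_sqrtr; first by apply: eq_bigr => m _; rewrite sqL2E.
by apply: sumr_ge0 => m _; exact: sq_ge0.
Qed.

Definition ipH2 U V : R :=
  \sum_m (ip (U m) (V m) + ip (d1 (U m)) (d1 (V m)) + ip (d2 (U m)) (d2 (V m))).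

Lemma sqH2E V : sqH2 T V = \sum_m (sq (V m) + sq (d1 (V m)) + sq (d2 (V m))).
Proof. by rewrite sqH2.unlock. Qed.

Lemma normH2_sqr V : normH2 T V ^+ 2 = sqH2 T V.
Proof.
have e0 := normL2_sqr V; have e1 := normL2_sqr (fun m => d1 (V m)).
have e2 := normL2_sqr (fun m => d2 (V m)).
have e : normH2 T V ^+ 2 = normL2 T V ^+ 2 + normL2 T (fun m => d1 (V m)) ^+ 2
    + normL2 T (fun m => d2 (V m)) ^+ 2.
  by apply: sqr_sqrtr; apply: addr_ge0; [apply: addr_ge0|]; exact: sqr_ge0.
apply: (etrans e); apply: (etrans (f_equal2 +%R (f_equal2 +%R e0 e1) e2)).
by rewrite sqH2E [RHS]big_split [X in _ = X + _]big_split.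
Qed.

Lemma sqH2_ge0 V : 0 <= sqH2 T V.
Proof. by rewrite sqH2E; apply: sumr_ge0 => m _; rewrite !addr_ge0// sqL2_ge0. Qed.

Lemma sqH2_axpy s U V : H2v T U -> H2v T V ->
  sqH2 T (fun m x => U m x + s * V m x) =
  sqH2 T U + 2 * s * ipH2 U V + s ^+ 2 * sqH2 T V.
Proof.
move=> HU HV; rewrite !sqH2E /ipH2.
transitivity (\sum_m ((sq (U m) + sq (d1 (U m)) + sq (d2 (U m))) +
  2 * s * (ip (U m) (V m) + ip (d1 (U m)) (d1 (V m)) + ip (d2 (U m)) (d2 (V m))) +
  s ^+ 2 * (sq (V m) + sq (d1 (V m)) + sq (d2 (V m))))); last first.
  by rewrite [LHS]big_split [X in X + _ = _]big_split /= !mulr_sumr.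
apply: eq_bigr => m _; have [Huv e1 e2] := H2_axpy s (HU m) (HV m).
have [Lu Lu1 Lu2 _ _] := H2_wderivP (HU m); have [Lv Lv1 Lv2 _ _] := H2_wderivP (HV m).
have [_ L1 L2 _ _] := H2_wderivP Huv.
have E0 := sqL2_axpy s Lu Lv.
have E1 := etrans (sqL2_ae L1 (in_L2_axpy mD s Lu1 Lv1) e1) (sqL2_axpy s Lu1 Lv1).
have E2 := etrans (sqL2_ae L2 (in_L2_axpy mD s Lu2 Lv2) e2) (sqL2_axpy s Lu2 Lv2).
have alg (a0 a1 a2 b0 b1 b2 c0 c1 c2 : R) : (a0 + 2 * s * b0 + s ^+ 2 * c0)
    + (a1 + 2 * s * b1 + s ^+ 2 * c1) + (a2 + 2 * s * b2 + s ^+ 2 * c2) =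
    (a0 + a1 + a2) + 2 * s * (b0 + b1 + b2) + s ^+ 2 * (c0 + c1 + c2) by ring.
exact: (etrans (f_equal2 +%R (f_equal2 +%R E0 E1) E2) (alg _ _ _ _ _ _ _ _ _)).
Qed.

(** The derivatives of [V] are only known up to almost everywhere equality; this
    form lets the L^2 limits of derivatives stand for them. *)
Lemma sqH2_sub_eq U V (g h : I -> R -> R) : H2v T U -> H2v T V ->
  (forall m, L2 T (g m)) -> (forall m, L2 T (h m)) ->
  (forall m, ae_eq mu D (d1 (V m)) (g m)) -> (forall m, ae_eq mu D (d2 (V m)) (h m)) ->
  sqH2 T (fun m x => U m x - V m x) =
  \sum_m (sq (fun x => U m x - V m x) + sq (fun x => d1 (U m) x - g m x)
    + sq (fun x => d2 (U m) x - h m x)).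
Proof.
move=> HU HV Lg Lh eg eh; rewrite sqH2E; apply: eq_bigr => m _.
have [Huv e1 e2] := H2_axpy (-1) (HU m) (HV m).
have [Lu Lu1 Lu2 _ _] := H2_wderivP (HU m); have [Lv Lv1 Lv2 _ _] := H2_wderivP (HV m).
move: Huv e1 e2; rewrite (_ : (fun x => U m x + -1 * V m x) = fun x => U m x - V m x); last first.
  by apply/funext => x; rewrite mulN1r.
move=> Huv e1 e2; have [_ L1 L2 _ _] := H2_wderivP Huv.
congr (_ + _ + _).
  apply: (sqL2_ae L1 (in_L2B mD Lu1 (Lg m))).
  by apply: filterS2 e1 (eg m) => x h1 h2 Dx; rewrite h1// h2// mulN1r.
apply: (sqL2_ae L2 (in_L2B mD Lu2 (Lh m))).
by apply: filterS2 e2 (eh m) => x h1 h2 Dx; rewrite h1// h2// mulN1r.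
Qed.

Lemma sqH2_component U V m : H2v T U -> H2v T V ->
  let W := (fun m x => U m x - V m x) in
  [/\ sq (fun x => U m x - V m x) <= sqH2 T W,
      sq (fun x => d1 (U m) x - d1 (V m) x) <= sqH2 T W
    & sq (fun x => d2 (U m) x - d2 (V m) x) <= sqH2 T W].
Proof.
move=> HU HV W.
rewrite (@sqH2_sub_eq U V (fun m => d1 (V m)) (fun m => d2 (V m)))//; last 4 first.
- by move=> k; case: (H2_wderivP (HV k)).
- by move=> k; case: (H2_wderivP (HV k)).
- by move=> k; exact: ae_eq_refl.
- by move=> k; exact: ae_eq_refl.
rewrite (bigD1 m)//=; set S := \sum_(_ | _) _.
have S0 : 0 <= S by apply: sumr_ge0 => k _; rewrite !addr_ge0// sqL2_ge0.
have := sqL2_ge0 T (fun x => U m x - V m x).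
have := sqL2_ge0 T (fun x => d1 (U m) x - d1 (V m) x).
have := sqL2_ge0 T (fun x => d2 (U m) x - d2 (V m) x).
by move=> *; split; lra.
Qed.

(** Values, first and second derivatives converge separately in L^2, and the
    limits are again weak derivatives of one another. *)
Lemma H2v_complete (U : nat -> I -> R -> R) : (forall n, H2v T (U n)) ->
  (forall e, 0 < e -> exists K, forall i j, (K <= i)%N -> (K <= j)%N ->
     sqH2 T (fun m x => U i m x - U j m x) <= e) ->
  exists2 V, H2v T V &
    sqH2 T (fun m x => U n m x - V m x) @[n --> \oo] --> (0 : R).
Proof.
move=> HU cauchy.
have HL n m := H2_wderivP (HU n m).
have /choice[V HV] : forall m, exists v, L2 T v /\
    sq (fun x => U n m x - v x) @[n --> \oo] --> (0 : R).
  move=> m; apply: (L2_complete T_gt0) => [n|e e0]; first by case: (HL n m).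
  have [K HK] := cauchy e e0; exists K => i j Ki Kj.
  have [h0 h1 h2] := sqH2_component m (HU i) (HU j).
  exact: le_trans (HK i j Ki Kj).
have /choice[g Hg] : forall m, exists v, L2 T v /\
    sq (fun x => d1 (U n m) x - v x) @[n --> \oo] --> (0 : R).
  move=> m; apply: (L2_complete T_gt0) => [n|e e0]; first by case: (HL n m).
  have [K HK] := cauchy e e0; exists K => i j Ki Kj.
  have [h0 h1 h2] := sqH2_component m (HU i) (HU j).
  exact: le_trans (HK i j Ki Kj).
have /choice[h Hh] : forall m, exists v, L2 T v /\
    sq (fun x => d2 (U n m) x - v x) @[n --> \oo] --> (0 : R).
  move=> m; apply: (L2_complete T_gt0) => [n|e e0]; first by case: (HL n m).
  have [K HK] := cauchy e e0; exists K => i j Ki Kj.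
  have [h0 h1 h2] := sqH2_component m (HU i) (HU j).
  exact: le_trans (HK i j Ki Kj).
have HVm m : [/\ H2 T (V m), ae_eq mu D (d1 (V m)) (g m) & ae_eq mu D (d2 (V m)) (h m)].
  have [LV cV] := HV m; have [Lg cg] := Hg m; have [Lh ch] := Hh m.
  have Ln n : L2 T (U n m) by case: (HL n m).
  have L1n n : L2 T (d1 (U n m)) by case: (HL n m).
  have L2n n : L2 T (d2 (U n m)) by case: (HL n m).
  have W1n n : is_weak_deriv T (U n m) (d1 (U n m)) by case: (HL n m) => _ _ _ w _; exact: w.
  have W2n n : is_weak_deriv T (d1 (U n m)) (d2 (U n m)) by case: (HL n m) => _ _ _ _ w; exact: w.
  exact: (H2P T_gt0 LV Lg Lh (weak_deriv_limL2 Ln LV L1n Lg cV cg W1n)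
    (weak_deriv_limL2 L1n Lg L2n Lh cg ch W2n)).
have H2V : H2v T V by move=> m; case: (HVm m).
exists V => //.
have E n : sqH2 T (fun m x => U n m x - V m x) =
  \sum_m (sq (fun x => U n m x - V m x) + sq (fun x => d1 (U n m) x - g m x)
    + sq (fun x => d2 (U n m) x - h m x)).
  apply: (sqH2_sub_eq (HU n) H2V) => m.
  - by case: (Hg m).
  - by case: (Hh m).
  - by case: (HVm m).
  - by case: (HVm m).
rewrite (funext E).
suff : \sum_m (sq (fun x => U n m x - V m x) + sq (fun x => d1 (U n m) x - g m x)
    + sq (fun x => d2 (U n m) x - h m x)) @[n --> \oo] --> \sum_(m : I) (0 + 0 + 0 : R).
  by rewrite big1// => m _; rewrite !addr0.
apply: cvg_big => [|m _]; first exact: add_continuous.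
by apply: cvgD; [apply: cvgD; [case: (HV m)|case: (Hg m)]|case: (Hh m)].
Qed.

End H2_vector.

(** * The basis functions as products of polynomials *)

Section tensor_polynomials.
Context {R : realType} {d : nat}.
Implicit Types (p : 'I_d -> {poly R}) (x : 'rV[R]_d).

Definition tensor_poly p x : R := \prod_(j < d) (p j).[x 0 j].

Definition deriv_factor p (j : 'I_d) : 'I_d -> {poly R} :=
  fun i => if i == j then (p j)^`()%R else p i.

(** Products of polynomials are stable under partial derivatives, so all
    derivatives of the basis functions are measurable and bounded on the cube
    without any computation. *)
Lemma partial_tensor_poly p j : partial j (tensor_poly p) = tensor_poly (deriv_factor p j).
Proof.
apply/funext => x; rewrite /partial.
pose C := \prod_(i < d | i != j) (p i).[x 0 i].
have E h : tensor_poly p (h *: delta_mx 0 j + x) = (p j).[h + x 0 j] * C.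
  rewrite /tensor_poly (bigD1 j)//= !mxE !eqxx mulr1; congr (_ * _).
  by apply: eq_bigr => i ij; rewrite !mxE eqxx (negbTE ij)/= mulr0 add0r.
have E0 : tensor_poly p x = (p j).[x 0 j] * C.
  by have := E 0; rewrite scale0r !add0r.
have -> : 'D_(delta_mx 0 j) (tensor_poly p) x = 'D_1 (fun y : R => (p j).[y] * C) (x 0 j).
  rewrite /derive /=; under eq_fun do rewrite E E0.
  by under [in RHS]eq_fun do rewrite [_ *: 1]mulr1.
have -> : (fun y : R => (p j).[y] * C) = horner (C *: p j).
  by apply/funext => y; rewrite hornerZ mulrC.
rewrite -derive1E -derivE derivZ hornerZ mulrC /tensor_poly [RHS](bigD1 j)//= /deriv_factor eqxx.
by congr (_ * _); apply: eq_bigr => i ij; rewrite (negbTE ij).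
Qed.

Definition Psi_poly (rho : R) (n : nat) : {poly R} :=
  Num.sqrt ((2 * n + 1)%:R / (2 * rho)) *: (legendre n \Po (rho^-1 *: 'X)).

Lemma Phi_tensor_poly rho (n : 'I_d -> nat) :
  Phi rho n = tensor_poly (fun j => Psi_poly rho (n j)).
Proof.
apply/funext => x; apply: eq_bigr => j _.
by rewrite /Psi /Psi_poly [RHS]hornerZ [in RHS]horner_comp [(rho^-1 *: 'X).[_]]hornerZ hornerX [rho^-1 * _]mulrC.
Qed.

End tensor_polynomials.

Section cube.
Context {R : realType} {d : nat}.
Local Notation Rd := (d.-tuple (measurableTypeR R)).
Local Notation lambda := (@lebesgue_tuple R d).
Variable rho : R.
Implicit Types (p : 'I_d -> {poly R}).

Lemma measurable_cube : measurable (cube rho : set Rd).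
Proof.
rewrite (_ : cube rho = \bigcap_(j in [set: 'I_d])
    ((fun x : Rd => tnth x j) @^-1` `]- rho, rho[%classic)); last first.
  by apply/seteqP; split => x /=; [move=> h j _; exact: h|move=> h j; exact: h].
apply: fin_bigcap_measurable => // j _.
rewrite -[X in measurable X]setTI; apply: measurable_tnth => //; exact: measurable_itv.
Qed.

Lemma lebesgue_cube_lty : (lambda (cube rho) < +oo)%E.
Proof.
rewrite [X in lambda X](_ : _ = [set x : Rd | forall j, `]- rho, rho[%classic (tnth x j)])//.
rewrite (lebesgue_tuple_box (A := fun=> `]- rho, rho[%classic)); last by move=> j; exact: measurable_itv.
set c := lebesgue_measure _.
suff [] : (\prod_(j < d) c < +oo /\ 0 <= \prod_(j < d) c)%E by [].
apply: (big_ind (fun x : \bar R => x < +oo /\ 0 <= x)%E).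
- by rewrite ltry lee_fin ler01.
- by move=> x y [xoo x0] [yoo y0]; rewrite mule_ge0// lte_mul_pinfty// ge0_fin_numE.
- by move=> j _; rewrite measure_ge0 /c /= lebesgue_measure_itv/=; case: ifP => _; rewrite ?ltry// -EFinB ltry.
Qed.

Lemma measurable_tensor_poly p : measurable_fun [set: Rd] (fun x => tensor_poly p (rv x)).
Proof.
rewrite /tensor_poly; apply: measurable_prod => j _.
under eq_fun do rewrite mxE.
apply: (measurableT_comp (f := horner (p j))); last exact: measurable_tnth.
by have cp : continuous (horner (p j)) := @continuous_horner R (p j); exact: (continuous_measurable_fun cp).
Qed.

Lemma bounded_tensor_poly p : exists M, forall x : Rd, cube rho x -> `|tensor_poly p (rv x)| <= M.
Proof.
have /choice[M HM] : forall j : 'I_d, exists M, forall t : R, t \in `]- rho, rho[ -> `|(p j).[t]| <= M.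
  move=> j; have : compact (horner (p j) @` `[- rho, rho]%classic).
    apply: continuous_compact; last exact: segment_compact.
    by apply: continuous_subspaceT; exact: continuous_horner.
  move=> /compact_bounded[M [_ HM]]; exists (M + 1) => t trho.
  apply: (HM (M + 1)); first by rewrite ltrDl.
  by exists t => //; exact: subset_itv_oo_cc.
exists (\prod_(j < d) M j) => x xC; rewrite /tensor_poly normr_prod.
by apply: ler_prod => j _; rewrite normr_ge0 mxE/= HM//; exact: xC.
Qed.

End cube.

(** * Essentially bounded functions and their slice integrals *)

Section ess_bounded.
Context {R : realType} d {X : measurableType d} (nu : {measure set X -> \bar R}).
Variable D : set X.
Hypothesis mD : measurable D.
Implicit Types (F G : X -> R).

Definition ess_bounded F : Prop := measurable_fun D F /\
  exists M, {ae nu, forall z, D z -> `|F z| <= M}.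

(** The L^oo norm is 0 by convention when the whole space is null, so that case
    is separate: every bound then holds almost everywhere. *)
Lemma in_Loo_ess_bounded F : in_Lp nu D +oo%E F -> ess_bounded F.
Proof.
rewrite /in_Lp inE => /andP[/[!inE]/= mF]; rewrite /finite_norm unlock /=.
split; first exact/(measurable_restrictT _ mD).
have restrE M : {ae nu, forall x, `|(F \_ D) x| <= M} -> {ae nu, forall z, D z -> `|F z| <= M}.
  by apply: filterS => x + Dx; rewrite patchE mem_set.
move: b; case: ifPn => [mu0 /ess_supr_bounded[M FM]|].
  by exists M; apply: restrE; apply: filterS FM.
rewrite -leNgt => mu0 _; exists 0; exists setT; split => //.
by apply/eqP; rewrite eq_le mu0 measure_ge0.
Qed.

Lemma ess_boundedM F G : ess_bounded F -> ess_bounded G ->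
  ess_bounded (fun x => F x * G x).
Proof.
move=> [mF [M FM]] [mG [K GK]]; split; first exact: measurable_funM.
exists (M * K); apply: filterS2 FM GK => x hF hG Dx.
by rewrite normrM ler_pM// ?hF ?hG.
Qed.

Lemma ess_boundedD F G : ess_bounded F -> ess_bounded G ->
  ess_bounded (fun x => F x + G x).
Proof.
move=> [mF [M FM]] [mG [K GK]]; split; first exact: measurable_funD.
exists (M + K); apply: filterS2 FM GK => x hF hG Dx.
by rewrite (le_trans (ler_normD _ _))// lerD ?hF ?hG.
Qed.

Lemma ess_boundedN F : ess_bounded F -> ess_bounded (fun x => - F x).
Proof.
move=> [mF [M FM]]; split; first exact: measurableT_comp.
by exists M; apply: filterS FM => x hF Dx; rewrite normrN hF.
Qed.

Lemma ess_bounded_sum (I : Type) (r : seq I) (F : I -> X -> R) :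
  (forall i, ess_bounded (F i)) -> ess_bounded (fun x => \sum_(i <- r) F i x).
Proof.
move=> bF; elim: r => [|i r IH].
  under eq_fun do rewrite big_nil.
  split; first exact: measurable_cst.
  by exists 0; apply: aeW => x _; rewrite normr0.
under eq_fun do rewrite big_cons.
exact: ess_boundedD.
Qed.

Lemma bounded_ess_bounded F M : measurable_fun D F ->
  (forall x, D x -> `|F x| <= M) -> ess_bounded F.
Proof. by move=> mF FM; split => //; exists M; exact: aeW. Qed.

End ess_bounded.

Section slices.
Context {R : realType} d1 d2 {X : measurableType d1} {Y : measurableType d2}.
Variables (m1 : {sigma_finite_measure set X -> \bar R})
  (m2 : {sigma_finite_measure set Y -> \bar R}).

Lemma measurable_slice_integral (F : X * Y -> R) : measurable_fun setT F ->
  measurable_fun setT (fun y => \int[m1]_x F (x, y)).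
Proof.
move=> mF; have mF0 : measurable_fun setT (EFin \o F) by exact/measurable_EFinP.
apply: measurableT_comp => //.
rewrite (_ : (fun y => _) = (fun y => \int[m1]_x ((EFin \o F)^\+ (x, y))
    - \int[m1]_x ((EFin \o F)^\- (x, y)))%E); last first.
  by apply/funext => y; rewrite [LHS]integralE; congr (_ - _)%E; apply: eq_integral => x _; rewrite ?funeposE ?funenegE.
apply: emeasurable_funB.
  apply: (measurable_fun_fubini_tonelli_G ((EFin \o F)^\+)%E) => //.
  exact: measurable_funepos.
apply: (measurable_fun_fubini_tonelli_G ((EFin \o F)^\-)%E) => //.
exact: measurable_funeneg.
Qed.

(** Tonelli's theorem for the indicator function of [N]. *)
Lemma negligible_ysection (N : set (X * Y)) : measurable N -> (m1 \x m2)%E N = 0%E ->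
  {ae m2, forall y, m1 (ysection N y) = 0%E}.
Proof.
move=> mN N0.
have mS : measurable_fun setT (m1 \o ysection N) by exact: measurable_fun_ysection.
have I0 : (\int[m2]_y `|(m1 \o ysection N) y| = 0)%E.
  under eq_integral do rewrite gee0_abs//.
  rewrite -[RHS]N0 -indic_fubini_tonelli_GE//.
  rewrite -indic_fubini_tonelli// -indic_fubini_tonelli1//.
  by rewrite integral_indic// setIT.
move/(ae_eq_integral_abs m2 measurableT mS) : I0.
by apply: filterS => y /(_ I).
Qed.

Variables (A : set X) (B : set Y).
Hypotheses (mA : measurable A) (mB : measurable B) (A_lty : (m1 A < +oo)%E).

(** For almost every [y] the section of the exceptional null set is null, and the
    integral is then at most the essential bound times the measure of [A]. *)
Lemma ess_bounded_slice (F : X * Y -> R) :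
  ess_bounded (m1 \x m2)%E (A `*` B) F ->
  ess_bounded m2 B (fun y => \int[m1]_(x in A) F (x, y)).
Proof.
move=> [mF [M [N [mN N0 FN]]]].
have mAB : measurable (A `*` B) by exact: measurableX.
pose F0 := F \_ (A `*` B).
have mF0 : measurable_fun setT (EFin \o F0).
  by apply/measurable_EFinP/(measurable_restrictT _ mAB).
have F0E y : B y -> (fun x => F0 (x, y)) = (fun x => F (x, y)) \_ A.
  move=> By; apply/funext => x; rewrite /F0 !patchE in_setX (mem_set By) andbT.
  by case: ifPn.
have intE y : B y -> (\int[m1]_(x in A) (F (x, y))%:E = \int[m1]_x (F0 (x, y))%:E)%E.
  move=> By; rewrite integral_mkcond; apply: eq_integral => x _.
  rewrite (_ : F0 (x, y) = ((fun x => F (x, y)) \_ A) x); last by rewrite -F0E.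
  by rewrite !patchE; case: ifPn.
have mslice y : measurable_fun setT (fun x => F0 (x, y)).
  apply/measurable_EFinP; exact: (measurableT_comp mF0 (pair2_measurable y)).
split.
  apply: (eq_measurable_fun (fun y => fine (\int[m1]_x (F0 (x, y))%:E)%E)).
    by move=> y; rewrite inE => By; rewrite /Rintegral intE.
  apply: measurable_funTS; apply: measurable_slice_integral; exact/measurable_EFinP.
exists (`|M| * fine (m1 A)).
apply: filterS (negligible_ysection mN N0) => y Ny By.
have le : (\int[m1]_(x in A) `|(F (x, y))%:E| <= (`|M| * fine (m1 A))%:E)%E.
  rewrite EFinM fineK ?ge0_fin_numE// -integral_cst//.
  have mAF : measurable_fun A (fun x => F (x, y)).
    by apply/(measurable_restrictT _ mA); rewrite -F0E.
  apply: ae_ge0_le_integral => //.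
  - by apply/measurable_EFinP; exact: measurableT_comp.
  - by move=> x _; rewrite lee_fin.
  exists (ysection N y); split => //; first exact: measurable_ysection.
  move=> x /= /not_implyP[Ax FM]; rewrite ysectionE/=; apply: FN => /= h; apply: FM.
  rewrite lee_fin; exact: le_trans (h (conj Ax By)) (ler_norm _).
have mAF : measurable_fun A (fun x => (F (x, y))%:E).
  by apply/measurable_EFinP/(measurable_restrictT _ mA); rewrite -F0E.
have abs_le := le_trans (le_abse_integral m1 mA mAF) le.
have fin : (\int[m1]_(x in A) (F (x, y))%:E)%E \is a fin_num.
  by rewrite fin_num_abs (le_lt_trans abs_le) ?ltry.
by rewrite -lee_fin /Rintegral -abse_EFin fineK.
Qed.

End slices.

(** * Bounded operators from H^2 to L^2 *)

Section bounded_operators.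
Context {R : realType} (T : R) {I : finType}.
Hypothesis T_gt0 : 0 < T.
Local Notation mu := (@lebesgue_measure R).
Local Notation D := (`]0, T[%classic : set (measurableTypeR R)).
Implicit Types (u v E : R -> R) (U V : I -> R -> R) (s : R).

Let mD := @measurable_oo R T.
Let muD : (mu D < +oo)%E. Proof. by rewrite mu_oo// ltry. Qed.

(** Linearity is required almost everywhere only, because weak derivatives are
    chosen representatives and do not add up pointwise. *)
Definition bounded_op (Phi : (I -> R -> R) -> R -> R) : Prop :=
  (forall s U V, H2v T U -> H2v T V ->
     ae_eq mu D (Phi (fun m x => U m x + s * V m x)) (fun x => Phi U x + s * Phi V x)) /\
  exists K, forall V, H2v T V -> L2 T (Phi V) /\ sqL2 T (Phi V) <= K * sqH2 T V.

Definition L2_bounded_op (A : (R -> R) -> R -> R) : Prop :=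
  (forall s u v, L2 T u -> L2 T v ->
     ae_eq mu D (A (fun x => u x + s * v x)) (fun x => A u x + s * A v x)) /\
  exists2 K, 0 <= K & forall u, L2 T u -> L2 T (A u) /\ sqL2 T (A u) <= K * sqL2 T u.

Lemma sqH2_ge_component V n :
  sqL2 T (V n) <= sqH2 T V /\ sqL2 T (wderiv T (V n)) <= sqH2 T V.
Proof.
rewrite sqH2E (bigD1 n)//=; set S := \sum_(_ | _) _.
have : 0 <= S by apply: sumr_ge0 => k _; rewrite !addr_ge0// sqL2_ge0.
move: (sqL2_ge0 T (V n)) (sqL2_ge0 T (wderiv T (V n))) (sqL2_ge0 T (wderiv T (wderiv T (V n)))).
move: (sqL2 _ _) (sqL2 _ _) (sqL2 _ _) S => a b c S ? ? ? ?; split; lra.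
Qed.

Lemma bounded_op_comp A n : L2_bounded_op A -> bounded_op (fun V => A (V n)).
Proof.
move=> [Al [K K0 HK]]; split.
  by move=> s U V HU HV; have [? _ _ _ _] := H2_wderivP (HU n);
    have [? _ _ _ _] := H2_wderivP (HV n); exact: Al.
exists K => V HV; have [Lv _ _ _ _] := H2_wderivP (HV n); have [LA AK] := HK _ Lv.
split => //; apply: (le_trans AK); rewrite ler_wpM2l//.
by have [] := sqH2_ge_component V n.
Qed.

Lemma bounded_op_wderiv n : bounded_op (fun V => wderiv T (V n)).
Proof.
split; first by move=> s U V HU HV; have [_ e _] := H2_axpy T_gt0 s (HU n) (HV n); exact: e.
exists 1 => V HV; have [_ L1 _ _ _] := H2_wderivP (HV n).
by split => //; rewrite mul1r; have [] := sqH2_ge_component V n.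
Qed.

(** 2 |Phi V|^2 + 2 |Psi V|^2 - |Phi V + Psi V|^2 is the square |Phi V - Psi V|^2. *)
Lemma bounded_opD Phi Psi : bounded_op Phi -> bounded_op Psi ->
  bounded_op (fun V x => Phi V x + Psi V x).
Proof.
move=> [l1 [K1 H1]] [l2 [K2 H2]]; split.
  move=> s U V HU HV; apply: filterS2 (l1 s U V HU HV) (l2 s U V HU HV) => x h1 h2 Dx.
  by rewrite h1// h2//; ring.
exists (2 * K1 + 2 * K2) => V HV; have [La a] := H1 V HV; have [Lb b] := H2 V HV.
split; first exact: (in_L2D mD).
have e1 := sqL2_axpy 1 La Lb; have e2 := sqL2_axpy (-1) La Lb.
have p := sqL2_ge0 T (fun x => Phi V x + -1 * Psi V x); rewrite e2 in p.
have -> : (fun x => Phi V x + Psi V x) = (fun x => Phi V x + 1 * Psi V x).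
  by apply/funext => x; rewrite mul1r.
rewrite e1.
move: a b p; move: (sqL2 T _) (sqL2 T _) (ipL2 T _ _) (sqH2 T V) => a b c q ? ? ?; lra.
Qed.

Lemma bounded_opN Phi : bounded_op Phi -> bounded_op (fun V x => - Phi V x).
Proof.
move=> [l1 [K1 H1]]; split.
  by move=> s U V HU HV; apply: filterS (l1 s U V HU HV) => x h Dx; rewrite h//; ring.
exists K1 => V HV; have [La a] := H1 V HV; split.
  by have := in_L2Z mD (-1) La; congr (in_Lp _ _ _ _); apply/funext => x; rewrite mulN1r.
by rewrite sqL2E; under eq_Rintegral do rewrite sqrrN; rewrite -sqL2E.
Qed.

Lemma bounded_op0 : bounded_op (fun V x => 0).
Proof.
split; first by move=> *; apply: aeW => x _; rewrite mulr0 addr0.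
exists 0 => V HV; split; first exact: (in_L2_0 mu mD).
by rewrite mul0r sqL2E Rintegral_eq0// => x _; rewrite expr0n.
Qed.

Lemma bounded_op_sum (J : Type) (r : seq J) (Phi : J -> (I -> R -> R) -> R -> R) :
  (forall j, bounded_op (Phi j)) -> bounded_op (fun V x => \sum_(j <- r) Phi j V x).
Proof.
move=> H; elim: r => [|j r IH].
  rewrite (_ : (fun V x => _) = (fun V x => 0)); first exact: bounded_op0.
  by apply/funext => V; apply/funext => x; rewrite big_nil.
rewrite (_ : (fun V x => _) = (fun V x => Phi j V x + \sum_(i <- r) Phi i V x)).
  exact: bounded_opD.
by apply/funext => V; apply/funext => x; rewrite big_cons.
Qed.

Lemma L2_bounded_mul E : ess_bounded mu D E -> L2_bounded_op (fun u x => E x * u x).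
Proof.
move=> [mE [M EM]]; split; first by move=> s u v _ _; apply: aeW => x _; ring.
exists (M ^+ 2); first exact: sqr_ge0.
by move=> u Lu; have [LE le] := in_L2_bounded mD mE EM Lu; rewrite !sqL2E.
Qed.

End bounded_operators.

Section convolution.
Context {R : realType} (T : R).
Hypothesis T_gt0 : 0 < T.
Local Notation mu := (@lebesgue_measure R).
Local Notation D := (`]0, T[%classic : set (measurableTypeR R)).
Implicit Types (u v E : R -> R) (s t : R).

Let mD := @measurable_oo R T.
Let muD : (mu D < +oo)%E. Proof. by rewrite mu_oo// ltry. Qed.

Lemma measurable_reflect t :
  measurable_fun setT ((fun x => t - x) : measurableTypeR R -> measurableTypeR R).
Proof. exact: measurable_funB. Qed.

(** Reflection maps null sets to null sets, which is what allows an essential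
    bound on [E] to be used for tau |-> E (t - tau). *)
Lemma lebesgue_measure_reflect t (N : set (measurableTypeR R)) : measurable N ->
  mu ((fun x => t - x) @^-1` N) = mu N.
Proof.
move=> mN; pose m : {measure set (measurableTypeR R) -> \bar R} :=
  measure_function_pushforward__canonical__measure_function_Measure mu (measurable_reflect t).
rewrite -[LHS]/(m N); apply/esym/lebesgue_measure_unique => //= _ [[a b]] _ <-.
rewrite /pushforward (_ : _ @^-1` _ = `[t - b, t - a[%classic).
  rewrite !lebesgue_measure_itv/= !lte_fin ltrD2l ltrN2.
  by case: ifP => // _; congr EFin; ring.
by apply/seteqP; split => x /=; rewrite !in_itv/= => /andP[? ?]; apply/andP; split; lra.
Qed.

Definition conv E u t : R := \int[mu]_(tau in `]0, t[%classic) (E (t - tau) * u tau).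

(** The essential bound [M] need not be nonnegative, hence the absolute value. *)
Lemma conv_integrand E u t M : measurable_fun D E ->
  {ae mu, forall x, D x -> `|E x| <= M} -> L2 T u -> D t ->
  let S := (`]0, t[%classic : set (measurableTypeR R)) in
  mu.-integrable S (EFin \o (fun tau => E (t - tau) * u tau)) /\
  `|conv E u t| <= `|M| * \int[mu]_(x in D) `|u x|.
Proof.
move=> mE [N [mN N0 EN]] Lu tD S; move: tD; rewrite /= in_itv/= => /andP[t0 tT].
have mS : measurable S by exact: measurable_itv.
have SD : S `<=` D by apply: subset_itv; rewrite bnd_simp// ltW.
have St tau : S tau -> D (t - tau).
  by rewrite /= !in_itv/= => /andP[? ?]; rewrite subr_gt0 ltrBlDr (lt_trans tT) ?ltrDl//; apply/andP.
have mE0 : measurable_fun setT (E \_ D) by exact/(measurable_restrictT _ mD).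
have mEt : measurable_fun S (fun tau => E (t - tau)).
  have : measurable_fun S ((E \_ D) \o (fun tau => t - tau)).
    by apply: measurable_funTS; exact: (measurableT_comp mE0 (measurable_reflect t)).
  by apply: eq_measurable_fun => tau; rewrite inE => /St tD; rewrite /= patchE mem_set.
have muS : measurable_fun S u by apply: (measurable_funS mD SD); exact: (in_L2_measurable mD Lu).
have iu := in_L2_integrable mD muD (in_L2_norm mD Lu).
have iuS : mu.-integrable S (EFin \o (fun x => `|M| * `|u x|)).
  by apply: (integrableZl_real mS); exact: (integrableS mD mS SD).
have le : {ae mu, forall tau, S tau -> `|E (t - tau) * u tau| <= `|M| * `|u tau|}.
  exists ((fun x => t - x) @^-1` N); split.
  - by rewrite -[X in measurable X]setTI; exact: (measurable_reflect t).
  - by rewrite lebesgue_measure_reflect.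
  move=> tau /= /not_implyP[tS h]; apply: EN => /= EM; apply: h.
  by rewrite normrM ler_wpM2r// (le_trans (EM (St _ tS)))// ler_norm.
have [ii bb] := ae_dominated_Rintegral mS (measurable_funM mEt muS) iuS le.
split => //; apply: (le_trans bb); rewrite RintegralZl//; last exact: (integrableS mD mS SD).
rewrite ler_wpM2l// -lee_fin (EFin_Rintegral mS); last exact: (integrableS mD mS SD).
rewrite (EFin_Rintegral mD)//; apply: ge0_subset_integral => //.
exact: (measurable_int mu iu).
Qed.

Lemma measurable_conv E u : measurable_fun D E -> measurable_fun D u ->
  measurable_fun D (conv E u).
Proof.
move=> mE mDu.
have mE0 : measurable_fun setT (E \_ D) by exact/(measurable_restrictT _ mD).
have mu0 : measurable_fun setT (u \_ D) by exact/(measurable_restrictT _ mD).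
pose A := [set z : measurableTypeR R * measurableTypeR R | z.1 < z.2].
have msub : measurable_fun setT (fun z : measurableTypeR R * measurableTypeR R =>
    z.2 - z.1 : measurableTypeR R).
  by apply: measurable_funB; [exact: measurable_snd|exact: measurable_fst].
have mA : measurable A.
  rewrite (_ : A = (fun z => z.2 - z.1) @^-1` `]0, +oo[%classic); last first.
    by apply/seteqP; split=> z /=; rewrite in_itv/= andbT subr_gt0.
  rewrite -[X in measurable X]setTI; apply: msub => //; exact: measurable_itv.
pose F (z : measurableTypeR R * measurableTypeR R) :=
  (E \_ D) (z.2 - z.1) * ((u \_ D) z.1 * \1_A z).
have mF : measurable_fun setT F.
  apply: measurable_funM; first exact: measurableT_comp mE0 msub.
  apply: measurable_funM; last exact: measurable_indic.
  exact: measurableT_comp mu0 measurable_fst.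
have mI := measurable_slice_integral mu mF.
apply: (eq_measurable_fun (fun t => \int[mu]_tau F (tau, t))); last exact: measurable_funTS.
move=> t; rewrite inE/= in_itv/= => /andP[t0 tT].
rewrite /conv [RHS]Rintegral_mkcond; congr (Rintegral _ _ _); apply/funext => tau.
rewrite /F /= [RHS]patchE indicE; case: ifPn => [|tS].
  rewrite inE/= in_itv/= => /andP[? ?].
  rewrite !patchE mem_set; last by rewrite /= in_itv/=; apply/andP; split; lra.
  rewrite mem_set; last by rewrite /= in_itv/=; apply/andP; split; lra.
  by rewrite mem_set// mulr1.
have [tau0|tau0] := leP tau 0.
  by rewrite [(u \_ D) _]patchE memNset ?mul0r ?mulr0//= in_itv/= ltNge tau0.
have [taut|taut] := ltP tau t.
  by move: tS; rewrite mem_set//= in_itv/= tau0.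
by rewrite memNset ?mulr0//= /A/= ltNge taut.
Qed.

(** The convolution is bounded pointwise by M times the L^1 norm of [u], hence in
    L^2 by M T times the L^2 norm of [u]. *)
Lemma L2_bounded_conv E : ess_bounded mu D E -> L2_bounded_op T (conv E).
Proof.
move=> [mE [M EM]]; split.
  move=> s u v Lu Lv; apply: aeW => t tD.
  have mS : measurable (`]0, t[%classic : set (measurableTypeR R)) by exact: measurable_itv.
  have [iu _] := conv_integrand mE EM Lu tD; have [iv _] := conv_integrand mE EM Lv tD.
  rewrite /conv -RintegralZl// -RintegralD//; last exact: (integrableZl_real mS).
  by apply: eq_Rintegral => x _; ring.
exists (M ^+ 2 * T ^+ 2); first by rewrite mulr_ge0// sqr_ge0.
move=> u Lu; set J := \int[mu]_(x in D) `|u x|.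
have mc := measurable_conv mE (in_L2_measurable mD Lu).
have cb : {ae mu, forall t, D t -> `|conv E u t| <= `|M| * J}.
  by apply: aeW => t tD; have [_] := conv_integrand mE EM Lu tD.
have [Lc1 le] := in_L2_bounded mD mc cb (in_L2_cst mD muD 1).
have cE : (fun t => conv E u t * cst 1 t) = conv E u by apply/funext => t; rewrite mulr1.
rewrite cE in Lc1; split => //.
have J2 : J ^+ 2 <= T * sqL2 T u.
  rewrite sqL2E; apply: (@le_trans _ _ (fine (mu D) * \int[mu]_(x in D) (u x ^+ 2))).
    exact: sqr_Rintegral_le.
  by rewrite mu_oo.
have s1 : \int[mu]_(x in D) ((cst 1 x : R) ^+ 2) = T.
  transitivity (fine (mu D)); last by rewrite mu_oo.
  by under eq_Rintegral do rewrite expr1n; rewrite Rintegral_cst// mul1r.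
have le' : sqL2 T (conv E u) <= (`|M| * J) ^+ 2 * T.
  by rewrite sqL2E -{2}s1 -{1}cE; exact: le.
apply: (le_trans le').
have h : J ^+ 2 * T <= T ^+ 2 * sqL2 T u.
  by rewrite (expr2 T) -mulrA mulrC; apply: ler_wpM2l J2; exact: ltW.
rewrite exprMn real_normK ?num_real//; have := ler_wpM2l (sqr_ge0 M) h.
by rewrite ![M ^+ 2 * (_ * _)]mulrA.
Qed.

End convolution.

(** * Least-squares systems of bounded affine equations in H^2 *)

Section least_squares_family.
Context {R : realType} (T : R) {I J : finType}.
Hypothesis T_gt0 : 0 < T.
Local Notation mu := (@lebesgue_measure R).
Local Notation D := (`]0, T[%classic : set (measurableTypeR R)).
Implicit Types (U V W : I -> R -> R) (s : R).
Local Notation q := (sqH2 T).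

Let mD := @measurable_oo R T.

Lemma ipH2_cauchy_schwarz U V : H2v T U -> H2v T V ->
  ipH2 T U V ^+ 2 <= q U * q V.
Proof.
move=> HU HV; apply: quadratic_ge0_discr; first exact: sqH2_ge0.
by move=> s; rewrite -sqH2_axpy//; exact: sqH2_ge0.
Qed.

Lemma axpy1_sub U V : U = (fun m x => V m x + 1 * (U m x - V m x)).
Proof. by apply/funext => m; apply/funext => x; rewrite mul1r addrC subrK. Qed.

Definition midpoint U V : I -> R -> R := fun m x => V m x + 2^-1 * (U m x - V m x).

Lemma H2v_midpoint U V : H2v T U -> H2v T V -> H2v T (midpoint U V).
Proof. by move=> HU HV; apply: (H2v_axpy T_gt0 _ HV); exact: (H2v_sub T_gt0). Qed.

Lemma sqH2_midpoint U V : H2v T U -> H2v T V ->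
  q (midpoint U V) = (q U + q V) / 2 - q (fun m x => U m x - V m x) / 4.
Proof.
move=> HU HV; have HW := H2v_sub T_gt0 HU HV.
have E s := sqH2_axpy T_gt0 s HV HW; have E1 := E 1; rewrite -axpy1_sub in E1.
rewrite E1 [q (midpoint _ _)]E.
move: (q V) (q _) (ipH2 _ _ _) => a b c; by field.
Qed.

Definition defect (Phi : (I -> R -> R) -> R -> R) (f : R -> R) V : R :=
  sqL2 T (fun x => Phi V x - f x).

Section one_operator.
Variables (Phi : (I -> R -> R) -> R -> R) (f : R -> R).
Hypotheses (bPhi : bounded_op T Phi) (Lf : L2 T f).

Lemma bounded_op_L2 V : H2v T V -> L2 T (Phi V).
Proof. by case: bPhi => _ [K HK] /HK[]. Qed.

Lemma defect_axpy s V W : H2v T V -> H2v T W ->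
  defect Phi f (fun m x => V m x + s * W m x) =
  defect Phi f V + 2 * s * ipL2 T (fun x => Phi V x - f x) (Phi W)
    + s ^+ 2 * sqL2 T (Phi W).
Proof.
move=> HV HW; have [lin _] := bPhi.
have LV := bounded_op_L2 HV; have LW := bounded_op_L2 HW.
have LX := bounded_op_L2 (H2v_axpy T_gt0 s HV HW).
rewrite /defect -(sqL2_axpy s (in_L2B mD LV Lf) LW).
apply: sqL2_ae; [exact: in_L2B|exact: (in_L2_axpy mD s (in_L2B mD LV Lf) LW)|].
by apply: filterS (lin s V W HV HW) => x h Dx; rewrite h//; ring.
Qed.

(** Convexity of a squared norm composed with an affine map. *)
Lemma defect_midpoint U V : H2v T U -> H2v T V ->
  defect Phi f (midpoint U V) <= (defect Phi f U + defect Phi f V) / 2.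
Proof.
move=> HU HV; have HW := H2v_sub T_gt0 HU HV.
have E s := defect_axpy s HV HW; have E1 := E 1; rewrite -axpy1_sub in E1.
rewrite E1 [defect _ _ (midpoint _ _)]E.
have := sqL2_ge0 T (Phi (fun m x => U m x - V m x)).
move: (defect _ _ _) (ipL2 _ _ _) (sqL2 _ _) => a b c; lra.
Qed.

(** The inequality |a + b|^2 <= 2 |a|^2 + 2 |b|^2 with a = Phi U - f and
    b = Phi (V - U); it makes the defect pass to limits. *)
Lemma defect_le : exists2 K, 0 <= K & forall U V, H2v T U -> H2v T V ->
  defect Phi f V <= 2 * defect Phi f U + K * q (fun m x => U m x - V m x).
Proof.
have [_ [K HK]] := bPhi; exists (2 * `|K|); first by rewrite mulr_ge0.
move=> U V HU HV; have HW := H2v_sub T_gt0 HU HV.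
have [LW le] := HK _ HW.
have E1 := defect_axpy 1 HV HW; have E2 := defect_axpy 2 HV HW.
rewrite -axpy1_sub in E1; rewrite E1.
(* The claim amounts to the nonnegativity of the defect at V + 2 (U - V). *)
have p2 : 0 <= defect Phi f (fun m x => V m x + 2 * (U m x - V m x)) by exact: sqL2_ge0.
rewrite E2 in p2.
have le' : sqL2 T (Phi (fun m x => U m x - V m x)) <= `|K| * q (fun m x => U m x - V m x).
  by apply: (le_trans le); rewrite ler_wpM2r ?ler_norm// sqH2_ge0.
have -> : 2 * `|K| * q (fun m x => U m x - V m x) = 2 * (`|K| * q (fun m x => U m x - V m x)).
  by rewrite mulrA.
move: le' p2 => {le}.
move: (`|K| * _) (defect _ _ _) (ipL2 _ _ _) (sqL2 _ _) => d a b c; lra.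
Qed.

End one_operator.

Variables (Phi : J -> (I -> R -> R) -> R -> R) (f : J -> R -> R).
Hypotheses (bPhi : forall j, bounded_op T (Phi j)) (Lf : forall j, L2 T (f j)).

Definition total_defect V : R := \sum_j defect (Phi j) (f j) V.

Lemma total_defect_ge0 V : 0 <= total_defect V.
Proof. by apply: sumr_ge0 => j _; exact: sqL2_ge0. Qed.

Lemma cvg_sqH2 (U : nat -> I -> R -> R) V : (forall n, H2v T (U n)) -> H2v T V ->
  q (fun m x => U n m x - V m x) @[n --> \oo] --> (0 : R) ->
  q (U n) @[n --> \oo] --> q V.
Proof.
move=> HU HV cv.
have HW n := H2v_sub T_gt0 (HU n) HV.
have E n : q (U n) = q V + (2 * ipH2 T V (fun m x => U n m x - V m x)
    + q (fun m x => U n m x - V m x)).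
  by rewrite [in LHS](axpy1_sub (U n) V) (sqH2_axpy T_gt0 1 HV (HW n)); ring.
rewrite (funext E) -[X in _ --> X]addr0; apply: cvgD; first exact: cvg_cst.
rewrite -[X in _ --> X]addr0; apply: cvgD => //.
rewrite -[X in _ --> X](mulr0 2); apply: cvgM; first exact: cvg_cst.
apply/norm_cvg0P.
apply: (@squeeze_cvgr _ _ _ _ (cst 0)
  (fun n => Num.sqrt (q V * q (fun m x => U n m x - V m x)))).
- apply: nearW => n; rewrite normr_ge0/= -sqrtr_sqr ler_sqrt ?mulr_ge0 ?sqH2_ge0//.
  exact: (ipH2_cauchy_schwarz HV (HW n)).
- exact: cvg_cst.
rewrite -[X in _ --> X](sqrtr0 R).
apply: (@continuous_cvg _ _ _ _ _ _ Num.sqrt); first exact: sqrt_continuous.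
by rewrite -[X in _ --> X](mulr0 (q V)); apply: cvgM => //; exact: cvg_cst.
Qed.

Lemma total_defect_le : exists K, forall U V, H2v T U -> H2v T V ->
  total_defect V <= 2 * total_defect U + K * q (fun m x => U m x - V m x).
Proof.
have /choice[K HK] : forall j, exists K, forall U V, H2v T U -> H2v T V ->
    defect (Phi j) (f j) V <= 2 * defect (Phi j) (f j) U + K * q (fun m x => U m x - V m x).
  by move=> j; have [K _ HK] := defect_le (bPhi j) (Lf j); exists K.
exists (\sum_j K j) => U V HU HV; rewrite /total_defect mulr_sumr mulr_suml -big_split/=.
by apply: ler_sum => j _; exact: HK.
Qed.

(** The selection principle applied to the solutions of finitely many bounded
    affine equations Phi_j V = f_j in H^2. *)
Theorem min_norm_stability :
  (exists2 V, H2v T V & total_defect V = 0) ->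
  exists Ustar, [/\ H2v T Ustar, total_defect Ustar = 0,
    forall V, H2v T V -> total_defect V = 0 -> q Ustar <= q V
    & forall e, 0 < e -> exists2 eta, 0 < eta & forall V, H2v T V ->
        total_defect V <= eta -> q V <= q Ustar + eta ->
        q (fun m x => V m x - Ustar m x) <= e].
Proof.
move=> ex; have [K HK] := total_defect_le.
refine (@min_norm_selection R _ (H2v T) q total_defect midpoint
  (fun U V => q (fun m x => U m x - V m x)) _ _ _ _ _ _ ex).
- exact: sqH2_ge0.
- exact: total_defect_ge0.
- exact: H2v_midpoint.
- exact: sqH2_midpoint.
- move=> U V HU HV; rewrite /total_defect -big_split mulr_suml /=.
  by apply: ler_sum => j _; exact: defect_midpoint.
move=> U HU cauchy; have [V HV cv] := H2v_complete T_gt0 HU cauchy.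
exists V => //; split; first exact: cvg_sqH2.
move=> c0; apply/eqP; rewrite eq_le total_defect_ge0 andbT.
have c1 : 2 * total_defect (U n) + K * q (fun m x => U n m x - V m x) @[n --> \oo] --> (0 : R).
  rewrite -[X in _ --> X]addr0; apply: cvgD.
    by rewrite -[X in _ --> X](mulr0 2); apply: cvgM => //; exact: cvg_cst.
  by rewrite -[X in _ --> X](mulr0 K); apply: cvgM => //; exact: cvg_cst.
have le n := HK _ _ (HU n) HV.
have pass (u : nat -> R) c : u n @[n --> \oo] --> (0 : R) -> (forall n, c <= u n) -> c <= 0.
  by move=> cu h; apply: (cvgr_to_ge cu); exact: nearW.
exact: (pass _ _ c1 le).
Qed.

End least_squares_family.

(** * The reduced coefficients are essentially bounded *)

Section coefficients.
Context {R : realType} {d : nat}.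
Local Notation mu := (@lebesgue_measure R).
Local Notation Rd := (d.-tuple (measurableTypeR R)).
Local Notation lambda := (@lebesgue_tuple R d).
Variables (rho T : R).
Local Notation D := (`]0, T[%classic : set (measurableTypeR R)).
Implicit Types (a : Rd * measurableTypeR R -> R) (p : 'I_d -> {poly R}).

Let mD := @measurable_oo R T.
Let mC := @measurable_cube R d rho.
Local Notation ebd := (ess_bounded (lambda \x mu)%E (cylinder rho T)).

Lemma measurable_cylinder : measurable (cylinder rho T : set (Rd * measurableTypeR R)).
Proof. exact: measurableX. Qed.

Lemma ess_bounded_tensor_poly p : ebd (fun z => tensor_poly p (rv z.1)).
Proof.
have [M HM] := bounded_tensor_poly rho p.
apply: (@bounded_ess_bounded _ _ _ _ _ _ M); last by move=> [x t] [/= Cx _]; exact: HM.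
apply: measurable_funTS.
exact: (measurableT_comp (measurable_tensor_poly p) measurable_fst).
Qed.

Lemma laplacian_Phi n : laplacian (Phi rho n) = fun x : 'rV[R]_d =>
  \sum_(j < d) tensor_poly
    (deriv_factor (deriv_factor (fun i => Psi_poly rho (n i)) j) j) x.
Proof.
apply/funext => x; apply: eq_bigr => j _.
by rewrite Phi_tensor_poly !partial_tensor_poly.
Qed.

Lemma ess_bounded_Phi (n : 'I_d -> nat) : ebd (fun z => Phi rho n (rv z.1)).
Proof. by rewrite Phi_tensor_poly; exact: ess_bounded_tensor_poly. Qed.

Lemma ess_bounded_laplacian_Phi (n : 'I_d -> nat) :
  ebd (fun z => laplacian (Phi rho n) (rv z.1)).
Proof.
rewrite laplacian_Phi.
exact: (ess_bounded_sum (index_enum 'I_d) (fun j => ess_bounded_tensor_poly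
  (deriv_factor (deriv_factor (fun i => Psi_poly rho (n i)) j) j))).
Qed.

Lemma ess_bounded_partial_Phi j (n : 'I_d -> nat) :
  ebd (fun z => partial j (Phi rho n) (rv z.1)).
Proof. by rewrite Phi_tensor_poly partial_tensor_poly; exact: ess_bounded_tensor_poly. Qed.

Let slice F := @ess_bounded_slice _ _ _ _ _ lambda mu _ _ mC mD (lebesgue_cube_lty rho) F.
Let Loo a : Linf rho T a -> ebd a := fun h => in_Loo_ess_bounded measurable_cylinder h.

(** The statement for an arbitrary bounded coefficient also covers the diffusion
    part of the other family of coefficients, which has the same form. *)
Lemma ess_bounded_Ecoef a (m n : 'I_d -> nat) : Linf rho T a ->
  ess_bounded mu D (Ecoef rho a m n).
Proof.
move=> /Loo aL.
have h := ess_boundedM aL (ess_bounded_laplacian_Phi n).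
exact: (slice (ess_boundedM h (ess_bounded_Phi m))).
Qed.

Lemma ess_bounded_Ccoef a b (m n : 'I_d -> nat) : Linf rho T a ->
  (forall j, Linf rho T (b j)) -> ess_bounded mu D (Ccoef rho a b m n).
Proof.
move=> aL bL; have ha := ess_bounded_Ecoef m n aL.
have hj j := ess_boundedM (Loo (bL j)) (ess_bounded_partial_Phi j n).
have hs := ess_bounded_sum (index_enum 'I_d) hj.
have hb := slice (ess_boundedM hs (ess_bounded_Phi m)).
exact: (ess_boundedD ha (ess_boundedN hb)).
Qed.

End coefficients.

(** * Constant functions and the terminal trace *)

Section constants_and_traces.
Context {R : realType} (T : R) {I : finType}.
Hypothesis T_gt0 : 0 < T.
Local Notation mu := (@lebesgue_measure R).
Local Notation D := (`]0, T[%classic : set (measurableTypeR R)).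
Implicit Types (U V : I -> R -> R) (c : I -> R).

Let mD := @measurable_oo R T.
Let muD : (mu D < +oo)%E. Proof. by rewrite mu_oo// ltry. Qed.

Lemma L2_cst (k : R) : L2 T (cst k).
Proof. exact: (in_L2_cst mD muD). Qed.

Lemma sqL2_cst (k : R) : sqL2 T (cst k) = T * k ^+ 2.
Proof.
rewrite sqL2E; transitivity (k ^+ 2 * fine (mu D)); last by rewrite mu_oo// mulrC.
rewrite -Rintegral_cst//.
Qed.

Lemma H2_cst (k : R) : [/\ H2 T (cst k), ae_eq mu D (wderiv T (cst k)) (cst 0)
  & ae_eq mu D (wderiv T (wderiv T (cst k))) (cst 0)].
Proof.
exact: (H2P T_gt0 (L2_cst k) (L2_cst 0) (L2_cst 0) (weak_deriv_cst T_gt0 k)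
  (weak_deriv_cst T_gt0 0)).
Qed.

Lemma H2v_cst c : H2v T (fun m => cst (c m)).
Proof. by move=> m; case: (H2_cst (c m)). Qed.

Lemma sqH2_cst c : sqH2 T (fun m => cst (c m)) = T * \sum_m c m ^+ 2.
Proof.
rewrite sqH2E mulr_sumr; apply: eq_bigr => m _.
have [Hc e1 e2] := H2_cst (c m); have [_ L1 L2 _ _] := H2_wderivP Hc.
rewrite (sqL2_ae L1 (L2_cst 0) e1) (sqL2_ae L2 (L2_cst 0) e2) !sqL2_cst.
by rewrite expr0n/= mulr0 !addr0.
Qed.

Lemma cont_rep_cst (k : R) : cont_rep T (cst k) T = k.
Proof.
apply: (@cont_rep_eq _ _ T_gt0 _ (cst k)); first exact: continuous_subspaceT (@cst_continuous _ _ _).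
  exact: ae_eq_refl.
by rewrite lexx ltW.
Qed.

Lemma cont_rep_add_cst V c m : H2v T V ->
  cont_rep T (fun x => V m x + 1 * cst (c m) x) T = cont_rep T (V m) T + c m.
Proof.
move=> HV; have [H1V _] := HV m; have [[H1c _] _ _] := H2_cst (c m).
by rewrite (cont_rep_axpy T_gt0 1 H1V H1c) ?cont_rep_cst ?mul1r// lexx ltW.
Qed.

(** The trace is encoded as a constant function of time so that terminal
    conditions and the equation itself are defects of the same kind. *)
Lemma bounded_op_trace (m : I) : bounded_op T (fun V => cst (cont_rep T (V m) T)).
Proof.
split.
  move=> s U V HU HV; apply: aeW => x _ /=.
  have [HU1 _] := HU m; have [HV1 _] := HV m.
  by rewrite (cont_rep_axpy T_gt0 s HU1 HV1)// lexx ltW.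
exists (2 + 2 * T ^+ 2) => V HV; split; first exact: L2_cst.
rewrite sqL2_cst; have [L0 L1 _ w _] := H2_wderivP (HV m).
apply: (le_trans (trace_boundL2 T_gt0 L0 L1 w)).
have [h0 h1] := sqH2_ge_component T V m.
have alg (u t g h : R) : u <= h -> t * g <= t * h -> 2 * u + 2 * t * g <= (2 + 2 * t) * h.
  by move=> uh tgh; lra.
exact: (alg _ _ _ _ h0 (ler_wpM2l (sqr_ge0 T) h1)).
Qed.

End constants_and_traces.

(** * The Tikhonov functional of the reduced problem *)

(** The constant is the sum of the coefficients of all error terms, so each term
    of the right-hand side absorbs the matching one. *)
Lemma tikhonov_arith_gap (R : realFieldType) (r u X K T S q delta eps : R) :
  0 <= K -> 0 <= T -> 0 <= S -> 0 <= q -> 0 < delta -> 0 < eps -> 0 <= r -> 0 <= u ->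
  X <= T * delta ^+ 2 ->
  r + eps * u <= K * (T * delta ^+ 2) + eps * (q + 2 * (S * delta) + T * delta ^+ 2) ->
  r + X <= (K * T + T + 2 * S + q) *
    (delta ^+ 2 + eps + eps * delta + eps * delta ^+ 2).
Proof.
move=> K0 T0 S0 q0 d0 e0 r0 u0 XT h; have dd0 := sqr_ge0 delta.
have eu0 : 0 <= eps * u by rewrite mulr_ge0// ltW.
pose A := K * T + T + 2 * S + q.
have KT0 : 0 <= K * T by exact: mulr_ge0.
have h1 : (K * T + T) * delta ^+ 2 <= A * delta ^+ 2.
  by apply: ler_wpM2r => //; rewrite /A; lra.
have h2 : q * eps <= A * eps by apply: ler_wpM2r; [exact: ltW|rewrite /A; lra].
have h3 : 2 * S * (eps * delta) <= A * (eps * delta).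
  by apply: ler_wpM2r; [rewrite mulr_ge0 ?ltW|rewrite /A; lra].
have h4 : T * (eps * delta ^+ 2) <= A * (eps * delta ^+ 2).
  by apply: ler_wpM2r; [rewrite mulr_ge0// ltW|rewrite /A; lra].
rewrite -/A; lra.
Qed.

Lemma tikhonov_arith_norm (R : realFieldType) (r u K T S q delta eps : R) :
  0 <= K -> 0 <= T -> 0 <= S -> 0 <= q -> 0 < delta -> 0 < eps -> 0 <= r ->
  r + eps * u <= K * (T * delta ^+ 2) + eps * (q + 2 * (S * delta) + T * delta ^+ 2) ->
  u <= q + (K * T + T + 2 * S + q) * (delta ^+ 2 / eps + delta + delta ^+ 2).
Proof.
move=> K0 T0 S0 q0 d0 e0 r0 h; have dd0 := sqr_ge0 delta.
have de0 : 0 <= delta ^+ 2 / eps by rewrite divr_ge0// ltW.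
pose A := K * T + T + 2 * S + q.
have KT0 : 0 <= K * T by exact: mulr_ge0.
have h1 : K * T * (delta ^+ 2 / eps) <= A * (delta ^+ 2 / eps).
  by apply: ler_wpM2r => //; rewrite /A; lra.
have h2 : 2 * S * delta <= A * delta by apply: ler_wpM2r; [exact: ltW|rewrite /A; lra].
have h3 : T * delta ^+ 2 <= A * delta ^+ 2 by apply: ler_wpM2r => //; rewrite /A; lra.
have hu : u <= K * T * (delta ^+ 2 / eps) + (q + 2 * (S * delta) + T * delta ^+ 2).
  rewrite -(ler_pM2l e0) mulrDr mulrCA (mulrCA eps) divff ?gt_eqF//; lra.
rewrite -/A; lra.
Qed.

Section tikhonov_stability.
Context {R : realType} {d : nat} (T rho : R) (N : 'I_d -> nat).
Local Notation Rd := (d.-tuple (measurableTypeR R)).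
Variables (a alpha : Rd * measurableTypeR R -> R)
  (b : 'I_d -> Rd * measurableTypeR R -> R).
Hypotheses (T_gt0 : 0 < T) (aL : Linf rho T a) (alphaL : Linf rho T alpha)
  (bL : forall j, Linf rho T (b j)).
Local Notation I := (mindex N).
Local Notation resid := (residual rho T a alpha b).
Local Notation q := (sqH2 T).
Implicit Types (U V W : I -> R -> R) (y c : I -> R).

Lemma bounded_op_residual (m : I) : bounded_op T (fun V => resid V m).
Proof.
have h1 := bounded_op_wderiv T_gt0 m.
have hC (n : I) := bounded_op_comp n (L2_bounded_mul (ess_bounded_Ccoef m n aL bL)).
have hE (n : I) := bounded_op_comp n (L2_bounded_conv T_gt0 (ess_bounded_Ecoef m n alphaL)).
have h2 := bounded_opN (bounded_op_sum (index_enum I) hC).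
have h3 := bounded_opN (bounded_op_sum (index_enum I) hE).
exact: (bounded_opD (bounded_opD h1 h2) h3).
Qed.

(** The equation and the terminal condition, as one family of operators; their
    right-hand sides are in [target]. *)
Definition constraint (j : I + I) : (I -> R -> R) -> R -> R :=
  match j with
  | inl m => fun V => resid V m
  | inr m => fun V => cst (cont_rep T (V m) T)
  end.

Definition target y (j : I + I) : R -> R :=
  match j with inl _ => cst 0 | inr m => cst (y m) end.

Lemma bounded_op_constraint j : bounded_op T (constraint j).
Proof. by case: j => m; [exact: bounded_op_residual|exact: bounded_op_trace]. Qed.

Lemma L2_target y j : L2 T (target y j).
Proof. by case: j => m; exact: L2_cst. Qed.

Local Notation gap y := (total_defect T constraint (target y)).
Local Notation sqres V := (\sum_m sqL2 T (resid V m)).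

Lemma gapE y V : gap y V =
  sqres V + T * \sum_m (cont_rep T (V m) T - y m) ^+ 2.
Proof.
rewrite /total_defect big_sumType /=; congr (_ + _).
  apply: eq_bigr => m _; rewrite /defect /=; congr (sqL2 T _).
  by apply/funext => x; rewrite subr0.
by rewrite mulr_sumr; apply: eq_bigr => m _; rewrite -(sqL2_cst T_gt0).
Qed.

Lemma gap_eq0 y V : gap y V = 0 -> sqres V = 0 /\ terminal_value T V y.
Proof.
rewrite gapE => /eqP; rewrite paddr_eq0; last 2 first.
- by apply: sumr_ge0 => m _; exact: sqL2_ge0.
- by rewrite mulr_ge0 ?(ltW T_gt0)//; apply: sumr_ge0 => m _; exact: sqr_ge0.
rewrite mulf_eq0 (gt_eqF T_gt0)/= => /andP[/eqP r0 t0]; split => // m.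
move: t0; rewrite psumr_eq0 => [|k _]; last exact: sqr_ge0.
by move=> /allP/(_ m (mem_index_enum _)); rewrite /= sqrf_eq0 subr_eq0 => /eqP.
Qed.

Lemma gap_eq0_exact y V : H2v T V -> gap y V = 0 -> exact_solutions rho T a alpha b y V.
Proof.
move=> HV /gap_eq0[/eqP r0 t0]; split => // m.
apply: sqL2_eq0; first exact: (bounded_op_L2 (bounded_op_residual m) HV).
by move: r0; rewrite psumr_eq0 => [/allP/(_ m (mem_index_enum _))/eqP|k _]; [|exact: sqL2_ge0].
Qed.

Lemma exact_solutions_gap y V : exact_solutions rho T a alpha b y V ->
  H2v T V /\ gap y V = 0.
Proof.
move=> [HV r0 t0]; split => //; rewrite gapE.
rewrite [X in X + _]big1 => [|m _]; last first.
  have LR := bounded_op_L2 (bounded_op_residual m) HV.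
  by rewrite (sqL2_ae LR (L2_cst T_gt0 0) (r0 m)) (sqL2_cst T_gt0) expr0n mulr0.
by rewrite big1 ?mulr0 ?addr0// => m _; rewrite t0 subrr expr0n.
Qed.

Lemma tikhonovE eps V : tikhonov rho T a alpha b eps V = sqres V + eps * q V.
Proof. by rewrite /tikhonov normL2_sqr normH2_sqr. Qed.

(** Shifting a solution by a constant vector creates a residual of the size of
    the shift. *)
Lemma sqres_add_cst : exists2 K, 0 <= K & forall V c, H2v T V -> sqres V = 0 ->
  sqres (fun m x => V m x + 1 * cst (c m) x) <= K * (T * \sum_m c m ^+ 2).
Proof.
have [K HK] := total_defect_le T_gt0 bounded_op_residual (fun=> L2_cst T_gt0 0).
have E V : total_defect T (fun m V => resid V m) (fun=> cst 0) V = sqres V.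
  by apply: eq_bigr => m _; congr (sqL2 T _); apply/funext => x; rewrite subr0.
exists `|K| => // V c HV r0.
have HW := H2v_axpy T_gt0 1 HV (H2v_cst T_gt0 c).
have := HK _ _ HV HW; rewrite !E r0 mulr0 add0r => h.
apply: (le_trans h); apply: (le_trans (ler_wpM2r (sqH2_ge0 _ _) (ler_norm K))).
rewrite ler_wpM2l// -(sqH2_cst T_gt0).
have -> : (fun m x => V m x - (V m x + 1 * cst (c m) x)) = (fun m => cst (- c m)).
  by apply/funext => m; apply/funext => x; rewrite /= mul1r; ring.
by rewrite !(sqH2_cst T_gt0) (eq_bigr _ (fun m _ => sqrrN (c m))).
Qed.

(** The minimizer is compared with Ustar shifted by the difference of the terminal
    data, which is admissible for the noisy problem. *)
Lemma tikhonov_estimate y Ustar : H2v T Ustar -> gap y Ustar = 0 ->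
  exists2 K, 0 <= K & forall (delta eps : R) yd U, 0 < delta -> 0 < eps ->
    \sum_m (yd m - y m) ^+ 2 <= delta ^+ 2 ->
    argmin (admissible T yd) (tikhonov rho T a alpha b eps) U ->
    [/\ H2v T U,
        gap y U <= K * (delta ^+ 2 + eps + eps * delta + eps * delta ^+ 2)
      & q U <= q Ustar + K * (delta ^+ 2 / eps + delta + delta ^+ 2)].
Proof.
move=> HU0 g0; have [r0 t0] := gap_eq0 g0.
have [K K0 HK] := sqres_add_cst.
(* By Cauchy-Schwarz, S delta bounds the inner product of Ustar with the shift,
   whose squared norm is at most T delta^2. *)
pose S := Num.sqrt (q Ustar * T); have S0 : 0 <= S by exact: sqrtr_ge0.
have T0 := ltW T_gt0; have q0 := sqH2_ge0 T Ustar.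
exists (K * T + T + 2 * S + q Ustar).
  by apply: addr_ge0 => //; apply: addr_ge0; [apply: addr_ge0 => //|]; exact: mulr_ge0.
move=> delta eps yd U d0 e0 noise [[HU tU] minU].
pose c m := yd m - y m; have Hc := H2v_cst T_gt0 c.
have adm : admissible T yd (fun m x => Ustar m x + 1 * cst (c m) x).
  split; first exact: (H2v_axpy T_gt0 1 HU0 Hc).
  by move=> m; rewrite (cont_rep_add_cst T_gt0 c m HU0) t0 /c addrC subrK.
have hmin := minU _ adm; rewrite !tikhonovE in hmin.
have hR := HK Ustar c HU0 r0.
rewrite (sqH2_axpy T_gt0 1 HU0 Hc) (sqH2_cst T_gt0) in hmin.
have Tc : T * \sum_m c m ^+ 2 <= T * delta ^+ 2 by rewrite ler_wpM2l.
have ipS : ipH2 T Ustar (fun m => cst (c m)) <= S * delta.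
  apply: (le_trans (ler_norm _)); rewrite -ler_sqr ?nnegrE ?normr_ge0 ?mulr_ge0 ?(ltW d0)//.
  rewrite real_normK ?num_real// exprMn sqr_sqrtr ?mulr_ge0//.
  apply: (le_trans (ipH2_cauchy_schwarz T_gt0 HU0 Hc)).
  by rewrite (sqH2_cst T_gt0) -mulrA ler_wpM2l.
have gapU : gap y U = sqres U + T * \sum_m c m ^+ 2.
  by rewrite gapE; congr (_ + T * _); apply: eq_bigr => m _; rewrite tU.
have RU0 : 0 <= sqres U by apply: sumr_ge0 => m _; exact: sqL2_ge0.
have hR' : sqres U + eps * q U <= K * (T * delta ^+ 2)
    + eps * (q Ustar + 2 * (S * delta) + T * delta ^+ 2).
  apply: (le_trans hmin); apply: lerD; first by apply: (le_trans hR); rewrite ler_wpM2l.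
  by rewrite ler_wpM2l ?(ltW e0)// expr1n mulr1 mul1r; apply: lerD => //; rewrite lerD2l ler_wpM2l.
split => //; first by rewrite gapU; exact: (tikhonov_arith_gap K0 T0 S0 q0 d0 e0 RU0 (sqH2_ge0 T U) Tc hR').
exact: (tikhonov_arith_norm K0 T0 S0 q0 d0 e0 RU0 hR').
Qed.

End tikhonov_stability.

(** * Convergence of the minimizers *)

Section normH2_order.
Context {R : realType} (T : R) {I : finType}.
Implicit Types (V W : I -> R -> R) (e : R).

Lemma normH2_ge0 V : 0 <= normH2 T V.
Proof. exact: sqrtr_ge0. Qed.

Lemma normH2_leE V e : 0 <= e -> (normH2 T V <= e) = (sqH2 T V <= e ^+ 2).
Proof.
move=> e0; rewrite -(normH2_sqr T V); move: (normH2_ge0 V); move: (normH2 T V) => n n0.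
by rewrite ler_sqr.
Qed.

Lemma le_normH2E V W : (normH2 T V <= normH2 T W) = (sqH2 T V <= sqH2 T W).
Proof. by rewrite (normH2_leE V (normH2_ge0 W)) normH2_sqr. Qed.

End normH2_order.

Theorem theorem2 (R : realType) (d : nat) (T rho : R)
    (a alpha : d.-tuple (measurableTypeR R) * measurableTypeR R -> R)
    (b : 'I_d -> d.-tuple (measurableTypeR R) * measurableTypeR R -> R)
    (uT : d.-tuple (measurableTypeR R) -> R)
    (uTd : R -> d.-tuple (measurableTypeR R) -> R)
    (N : 'I_d -> nat)
    (U : R -> R -> mindex N -> R -> R)
    (d_ge1 : (1 <= d)%N) (T_gt0 : 0 < T) (rho_gt0 : 0 < rho)
    (a_Linf : Linf rho T a) (a_ge0 : ae_ge0 rho T a)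
    (alpha_Linf : Linf rho T alpha) (alpha_ge0 : ae_ge0 rho T alpha)
    (b_Linf : forall j, Linf rho T (b j))
    (uT_L2 : in_Lp (lebesgue_tuple d) (cube rho) 2%:E uT)
    (uTd_L2 : forall delta : R, 0 < delta ->
       in_Lp (lebesgue_tuple d) (cube rho) 2%:E (uTd delta))
    (noise : forall delta : R, 0 < delta ->
       norm2 (fun m => moments rho N (uTd delta) m - moments rho N uT m)
         <= delta)
    (U_min : forall delta eps : R, 0 < delta -> 0 < eps ->
       argmin (admissible T (moments rho N (uTd delta)))
         (tikhonov rho T a alpha b eps) (U delta eps))
    (S_neq0 : exact_solutions rho T a alpha b (moments rho N uT) !=set0) :
  let S := exact_solutions rho T a alpha b (moments rho N uT) in
  exists Ustar : mindex N -> R -> R,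
    [/\ argmin S (normH2 T) Ustar,
        forall V, argmin S (normH2 T) V ->
          forall m, ae_eq lebesgue_measure `]0, T[%classic (V m) (Ustar m)
      & forall delta eps : nat -> R,
          (forall k, 0 < delta k) -> (forall k, 0 < eps k) ->
          delta k @[k --> \oo] --> 0 -> eps k @[k --> \oo] --> 0 ->
          delta k ^+ 2 / eps k @[k --> \oo] --> 0 ->
          normH2 T (fun m t => U (delta k) (eps k) m t - Ustar m t)
            @[k --> \oo] --> 0].

Proof.
move=> S; set y := moments rho N uT in S S_neq0 noise *.
have [V0 /(exact_solutions_gap T_gt0 a_Linf alpha_Linf b_Linf)[HV0 gV0]] := S_neq0.
have bc (j : mindex N + mindex N) := bounded_op_constraint T_gt0 a_Linf alpha_Linf b_Linf j.
have Lt := L2_target T_gt0 y.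
have [] := min_norm_stability T_gt0 bc Lt; first by exists V0.
move=> Ustar [HU0 g0 minU stab].
have SUstar := gap_eq0_exact T_gt0 a_Linf alpha_Linf b_Linf HU0 g0.
exists Ustar; split.
- split; first exact: SUstar.
  move=> V SV; have [HV gV] := exact_solutions_gap T_gt0 a_Linf alpha_Linf b_Linf SV.
  by rewrite le_normH2E; exact: (minU V HV gV).
- move=> V [SV minV] m.
  have [HV gV] := exact_solutions_gap T_gt0 a_Linf alpha_Linf b_Linf SV.
  have qV : sqH2 T V <= sqH2 T Ustar.
    by rewrite -le_normH2E; exact: (minV _ SUstar).
  (* A second minimizer meets the stability conditions for every eta. *)
  have d0 : sqH2 T (fun m x => V m x - Ustar m x) <= 0.
    apply/ler_addgt0Pl => e e0; rewrite addr0; have [eta eta0 H] := stab e e0.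
    apply: (H V HV); first by rewrite gV ltW.
    by apply: (le_trans qV); rewrite lerDl ltW.
  have [h _ _] := sqH2_component T_gt0 m HV HU0.
  have s0 : sqL2 T (fun x => V m x - Ustar m x) = 0.
    by apply/eqP; rewrite eq_le sqL2_ge0 (le_trans h d0).
  have [LV _ _ _ _] := H2_wderivP (HV m); have [LU _ _ _ _] := H2_wderivP (HU0 m).
  have := sqL2_eq0 (in_L2B (@measurable_oo R T) LV LU) s0.
  by apply: filterS => x h0 Dx; apply/eqP; rewrite -subr_eq0; apply/eqP; exact: h0.
move=> delta eps d0 e0 dc ec dec.
have [K K0 est] := tikhonov_estimate T_gt0 a_Linf alpha_Linf b_Linf HU0 g0.
have noise2 k : \sum_m (moments rho N (uTd (delta k)) m - y m) ^+ 2 <= delta k ^+ 2.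
  have := noise _ (d0 k); rewrite -ler_sqr ?nnegrE ?sqrtr_ge0 ?(ltW (d0 k))//.
  by rewrite sqr_sqrtr//; apply: sumr_ge0 => m _; exact: sqr_ge0.
have est_k k := est _ _ _ _ (d0 k) (e0 k) (noise2 k) (U_min _ _ (d0 k) (e0 k)).
have d2c : delta k ^+ 2 @[k --> \oo] --> (0 : R).
  by rewrite -[X in _ --> X](mulr0 0); under eq_fun do rewrite expr2; exact: cvgM.
have gapc : K * (delta k ^+ 2 + eps k + eps k * delta k + eps k * delta k ^+ 2)
    @[k --> \oo] --> (0 : R).
  rewrite -[X in _ --> X](mulr0 K); apply: cvgM; first exact: cvg_cst.
  rewrite [X in _ --> X](_ : 0 = 0 + 0 + 0 * 0 + 0 * 0 :> R); last by rewrite mulr0 !addr0.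
  by apply: cvgD; [apply: cvgD; [exact: cvgD|exact: cvgM]|exact: cvgM].
have normc : K * (delta k ^+ 2 / eps k + delta k + delta k ^+ 2)
    @[k --> \oo] --> (0 : R).
  rewrite -[X in _ --> X](mulr0 K); apply: cvgM; first exact: cvg_cst.
  rewrite [X in _ --> X](_ : 0 = 0 + 0 + 0 :> R); last by rewrite !addr0.
  by apply: cvgD => //; exact: cvgD.
have small (u : nat -> R) (eta : R) : 0 < eta -> u k @[k --> \oo] --> (0 : R) ->
    \forall k \near \oo, u k <= eta.
  by move=> eta0 cu; exact: (cvgr_le _ cu).
apply/cvgr0Pnorm_le => e epos.
have [eta eta0 H] := stab (e ^+ 2) (exprn_gt0 2 epos).
have near1 := small _ _ eta0 gapc; have near2 := small _ _ eta0 normc.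
apply: filterS2 near1 near2 => k g1 g2; have [HU gU qU] := est_k k.
rewrite (ger0_norm (normH2_ge0 _ _)) (normH2_leE _ _ (ltW epos)).
apply: (H _ HU (le_trans gU g1)); apply: (le_trans qU); by rewrite lerD2l.
Qed.
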